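(* Consider the classical Hammersley model. Then $$\lim_{\varepsilon\to0}\ \limsup_{t\to\infty}\ \mathbb{P}\big(0\le Z_1(t,t)\le\varepsilon t^{2/3}\big)=0.$$
   Context: Let $\mathbf P$ be a homogeneous Poisson process of intensity one in $\mathbb R\times(0,\infty)$, all weights equal to $1$; $L(\mathbf p,\mathbf q)$ is the maximal number of points of $\mathbf P$ in a coordinatewise increasing chain inside $\{\mathbf x:p_1<x_1\le q_1,\ p_2<x_2\le q_2\}$. Let $\nu_1$ be a homogeneous Poisson process of intensity $1$ on $\mathbb R$, independent of $\mathbf P$, with counting function $\nu_1(x)=\nu_1((0,x])$ for $x\ge0$, $\nu_1(x)=-\nu_1((x,0])$ for $x<0$. Define $L_1(x,t)=\sup_{z\le x}\{\nu_1(z)+L((z,0),(x,t))\}$ and the exit point $Z_1(x,t)=\sup\{z\le x: L_1(x,t)=\nu_1(z)+L((z,0),(x,t))\}$. *)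

(* Defs.v *)
From HB Require Import structures.
From mathcomp Require Import all_boot all_order all_algebra.
From mathcomp Require Import finmap.
From mathcomp Require Import all_classical all_reals all_analysis.
Set Implicit Arguments. Unset Strict Implicit. Unset Printing Implicit Defensive.
Import Order.TTheory GRing.Theory Num.Theory.
Import numFieldNormedType.Exports.
Local Open Scope classical_set_scope.
Local Open Scope ring_scope.

Section hammersley.
Context {R : realType}.

(* number of points of a (finite) set; 0 for an infinite set *)
Definition npts {T : choiceType} (A : set T) : nat := #|` fset_set A|%fset.

(* Poisson(r) probability of the value k, valid also for r = 0 *)
Definition poisson_law (r : R) (k : nat) : R := r ^+ k / k`!%:R * expR (- r).

Definition bounded2 (B : set (R * R)) : Prop :=
  exists M : R, forall x, B x -> `|x.1| <= M /\ `|x.2| <= M.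
Definition bounded1 (A : set R) : Prop :=
  exists M : R, forall x, A x -> `|x| <= M.

Definition upper_half : set (R * R) := [set x | 0 < x.2].

Definition lt2 : rel (R * R) := fun p q => (p.1 < q.1) && (p.2 < q.2).

Definition hbox (p q : R * R) : set (R * R) :=
  [set u | p.1 < u.1 <= q.1 /\ p.2 < u.2 <= q.2].

Definition Lpp (N : set (R * R)) (p q : R * R) : R :=
  sup [set (size s)%:R | s in
        [set s : seq (R * R) | (forall u, u \in s -> (N `&` hbox p q) u)
                               /\ sorted lt2 s]].

Definition nu1 (Nu : set R) (x : R) : R :=
  if 0 <= x then (npts (Nu `&` `]0, x]))%:R
  else - (npts (Nu `&` `]x, 0]))%:R.

Definition L1 (N : set (R * R)) (Nu : set R) (x t : R) : R :=
  sup [set nu1 Nu z + Lpp N (z, 0) (x, t) | z in [set z | z <= x]].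

Definition Z1 (N : set (R * R)) (Nu : set R) (x t : R) : R :=
  sup [set z | z <= x /\ L1 N Nu x t = nu1 Nu z + Lpp N (z, 0) (x, t)].

End hammersley.

Definition lebesgue2 {R : realType} : set (R * R) -> \bar R :=
  ((@lebesgue_measure R) \x (@lebesgue_measure R))%E.

Section setting.
Context {R : realType} {d : measure_display} {Omega : measurableType d}.
Local Open Scope ereal_scope.

(* Pts is a homogeneous Poisson process of intensity one on R x (0,oo)
   (Lebesgue intensity), Nu is a homogeneous Poisson process of intensity
   one on R, and the two are independent.  Configurations are locally finite
   simple point sets; independence is the product rule for the counts in
   any finite families of pairwise disjoint bounded Borel sets. *)
Definition hammersley_setting (P : probability Omega R)
    (Pts : Omega -> set (R * R)) (Nu : Omega -> set R) : Prop :=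
  [/\ (forall w, Pts w `<=` upper_half),
      (forall w (B : set (R * R)), bounded2 B -> finite_set (Pts w `&` B)),
      (forall w (A : set R), bounded1 A -> finite_set (Nu w `&` A)) &
    [/\
      (forall (B : set (R * R)) (k : nat), measurable B -> bounded2 B ->
         B `<=` upper_half ->
         measurable [set w | npts (Pts w `&` B) = k] /\
         P [set w | npts (Pts w `&` B) = k] =
           (poisson_law (fine (lebesgue2 B)) k)%:E),
      (forall (A : set R) (k : nat), measurable A -> bounded1 A ->
         measurable [set w | npts (Nu w `&` A) = k] /\
         P [set w | npts (Nu w `&` A) = k] =
           (poisson_law (fine (@lebesgue_measure R A)) k)%:E) &
      (forall (n m : nat) (B : 'I_n -> set (R * R)) (k : 'I_n -> nat)
              (A : 'I_m -> set R) (l : 'I_m -> nat),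
         (forall i, [/\ measurable (B i), bounded2 (B i) & B i `<=` upper_half]) ->
         (forall j, measurable (A j) /\ bounded1 (A j)) ->
         (forall i i', i != i' -> B i `&` B i' = set0) ->
         (forall j j', j != j' -> A j `&` A j' = set0) ->
         P (\big[setI/setT]_(i < n) [set w | npts (Pts w `&` B i) = k i]
            `&` \big[setI/setT]_(j < m) [set w | npts (Nu w `&` A j) = l j]) =
         (\prod_(i < n) P [set w | npts (Pts w `&` B i) = k i]) *
         (\prod_(j < m) P [set w | npts (Nu w `&` A j) = l j]))]].

Definition exit_event (Pts : Omega -> set (R * R)) (Nu : Omega -> set R)
    (eps t : R) : set Omega :=
  [set w | (0 <= Z1 (Pts w) (Nu w) t t <= eps * t `^ (2 / 3))%R].

End setting.

(* Main.v *)
Require Import Defs.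
From HB Require Import structures.
From mathcomp Require Import all_boot all_order all_algebra.
From mathcomp Require Import finmap.
From mathcomp Require Import all_classical all_reals all_analysis.
From mathcomp Require Import measurable_realfun.
From mathcomp Require Import lra ring zify.
Set Implicit Arguments. Unset Strict Implicit. Unset Printing Implicit Defensive.
Import Order.TTheory GRing.Theory Num.Theory.
Import numFieldNormedType.Exports.
Local Open Scope classical_set_scope.
Local Open Scope ring_scope.

(* Put [f z = nu1 z + L((z,0),(t,t))] and [s = t^(2/3)], and let [D lam] be the
   event that, in a window of width [O(s)] around the origin, the maximum of
   [nu1 z + L((z,0),(t,t/lam))] is attained on the image of [[-s/K, s/K]] under
   the map [z |-> t + lam (z - t)].  By the invariance of the Poisson process
   under [(x, y) |-> (lam x, y / lam)], [D lam] has the probability that [D 1]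
   would have if [nu1] had intensity [lam].
   For [lam = 1 + 4k/(K t^(1/3))], [k < K], these events are disjoint: as [lam]
   grows the target interval moves to the left, while by planarity of the
   maximal chains lowering the end point moves the maximiser to the right.
   On the other hand, changing the intensity of [nu1] from [1] to [lam] in the
   window costs only a constant, since [(lam - 1)^2 s = O(1)]: so [P (D 1)] is at
   most [C (a P (D lam) + 1/a)] for every [a], and averaging over [k] gives
   [P (D 1) <= C (a/K + 1/a)].
   Finally [0 <= Z1 < s/K] implies [D 1] unless [f] is unbounded (in which case
   the library's [sup] takes the junk value 0); Poisson concentration in thin
   rows shows that this has probability 0. *)

(** * Cardinalities of finite point sets *)

Section counting.
Context {T : choiceType}.
Implicit Types A B : set T.

Lemma npts_disjU A B : finite_set A -> finite_set B -> A `&` B = set0 ->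
  npts (A `|` B) = (npts A + npts B)%N.
Proof.
move=> fA fB AB; rewrite /npts fset_setU// cardfsU -fset_setI// AB fset_set0.
by rewrite cardfs0 subn0.
Qed.

Lemma npts_le A B : finite_set B -> A `<=` B -> (npts A <= npts B)%N.
Proof.
move=> fB AB; apply: fsubset_leq_card.
by rewrite -fset_set_sub//; exact: sub_finite_set fB.
Qed.

Lemma npts_gt0 A : finite_set A -> (0 < npts A)%N <-> A !=set0.
Proof.
move=> fA; rewrite /npts cardfs_gt0; split.
  by move/fset0Pn => [x]; rewrite in_fset_set// inE => Ax; exists x.
by move=> [x Ax]; apply/fset0Pn; exists x; rewrite in_fset_set// inE.
Qed.

Lemma npts_uniq A (s : seq T) : finite_set A -> uniq s ->
  (forall x, x \in s -> A x) -> (size s <= npts A)%N.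
Proof.
move=> fA us sA; rewrite /npts.
have <- : #|` [fset x in s]%fset|%fset = size s.
  by rewrite card_fseq undup_id.
apply: fsubset_leq_card; apply/fsubsetP => x.
by rewrite inE /= => /sA Ax; rewrite in_fset_set// inE.
Qed.

End counting.

(** * Increasing chains, last-passage times and planarity *)

Section chains.
Context {R : realType}.
Implicit Types (N : set (R * R)) (p q u v : R * R) (k n m : nat).

(** Recursing on the first point makes the rest of a chain a chain from a new starting point, so
    that chains can be compared by induction; [chain_seq] links this to the sorted sequences of
    [Lpp]. *)
Fixpoint chain N q k p : Prop :=
  if k is k'.+1 then exists u, [/\ N u, hbox p q u & chain N q k' u]
  else True.

(** A simulation principle: a relation between starting points that survives one step transports
    whole chains. It serves for monotonicity and for both directions of the comparison with a
    grid. *)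
Lemma chain_sim N N' q q' (S : R * R -> R * R -> Prop) :
  (forall p p' u, S p p' -> N u -> hbox p q u ->
     exists u', [/\ N' u', hbox p' q' u' & S u u']) ->
  forall k p p', S p p' -> chain N q k p -> chain N' q' k p'.
Proof.
move=> step; elim=> [//|k IH] p p' Spp' [u [Nu pqu cu]].
have [u' [N'u' pqu' Suu']] := step _ _ _ Spp' Nu pqu.
by exists u'; split => //; exact: IH Suu' cu.
Qed.

Lemma chain_sub N q q' p p' k : p'.1 <= p.1 -> p'.2 <= p.2 ->
  q.1 <= q'.1 -> q.2 <= q'.2 -> chain N q k p -> chain N q' k p'.
Proof.
move=> h1 h2 h3 h4.
apply: (@chain_sim N N q q' (fun p p' => p'.1 <= p.1 /\ p'.2 <= p.2)) => //.
move=> [a b] [a' b'] [x y] /= [ha hb] Nu [/= /andP[h5 h6] /andP[h7 h8]].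
exists (x, y); split => //; rewrite /hbox /=.
by split; apply/andP; split; lra.
Qed.

Lemma chain_le N q k k' p : (k' <= k)%N -> chain N q k p -> chain N q k' p.
Proof.
elim: k k' p => [|k IH] [|k'] p //= kk' [u [Nu pqu cu]].
by exists u; split => //; exact: IH cu.
Qed.

Lemma lt2_trans : transitive (@lt2 R).
Proof.
move=> [a b] [c d] [e f] /andP[/= h1 h2] /andP[/= h3 h4].
by rewrite /lt2 /=; apply/andP; split; lra.
Qed.

Lemma chain_seq N q k p : chain N q k p <->
  exists s : seq (R * R), [/\ size s = k,
    (forall u, u \in s -> (N `&` hbox p q) u) & sorted (@lt2 R) s].
Proof.
split.
  elim: k p => [|k IH] p /=; first by move=> _; exists [::].
  move=> [u [Nu pqu /IH [s [ss sN sort]]]]; exists (u :: s); split => /=.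
  - by rewrite ss.
  - move=> v; rewrite inE => /predU1P[->//|vs].
    have [Nv [/= /andP[a b] /andP[c d]]] := sN _ vs; split => //.
    case: pqu => /= /andP[a' b'] /andP[c' d'].
    by split; apply/andP; split; lra.
  - rewrite (path_sortedE lt2_trans) sort andbT; apply/allP => v vs.
    by have [Nv [/= /andP[a b] /andP[c d]]] := sN _ vs; rewrite /lt2 a c.
elim: k p => [//|k IH] p [[|u s] [//= [ss] sN sort]].
have us : u \in u :: s by rewrite mem_head.
have [Nu pqu] := sN _ us.
exists u; split => //; apply: IH; exists s; split => //; last first.
  exact: path_sorted sort.
move=> v vs; have [|Nv pqv] := sN v; first by rewrite inE vs orbT.
split => //; move: sort; rewrite (path_sortedE lt2_trans) => /andP[/allP/(_ _ vs)].
case: pqv => /= /andP[_ h1] /andP[_ h2] /andP[h3 h4] _.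
by rewrite /hbox/= h1 h2 h3 h4.
Qed.

Lemma chain_npts N q k p : finite_set (N `&` hbox p q) ->
  chain N q k p -> (k <= npts (N `&` hbox p q))%N.
Proof.
move=> fN /chain_seq[s [<- sN sort]]; apply: npts_uniq => //.
apply: sorted_uniq sort => //; first exact: lt2_trans.
by move=> u; rewrite /lt2 ltxx.
Qed.

(** Chain lengths are bounded by the number of points in the box, so the supremum is a maximum, and
    shorter chains come from truncation. *)
Lemma LppP N p q : finite_set (N `&` hbox p q) ->
  exists2 n : nat, Lpp N p q = n%:R & forall k, chain N q k p <-> (k <= n)%N.
Proof.
move=> fN.
have ex0 : exists k, `[< chain N q k p >] by exists 0%N; exact/asboolP.
have ub k : `[< chain N q k p >] -> (k <= npts (N `&` hbox p q))%N.
  by move=> /asboolP; exact: chain_npts.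
case: (ex_maxnP ex0 ub) => n /asboolP cn nmax; exists n; last first.
  move=> k; split; first by move=> ck; apply/nmax/asboolP.
  by move=> kn; exact: chain_le cn.
have Hub x : [set (size s)%:R | s in [set s : seq (R * R) |
    (forall u, u \in s -> (N `&` hbox p q) u) /\ sorted lt2 s]] x -> x <= n%:R :> R.
  move=> [s [sN sort] <-]; rewrite ler_nat; apply/nmax/asboolP/chain_seq.
  by exists s.
have [s [ss sN sort]] := (chain_seq _ _ _ _).1 cn.
apply/eqP; rewrite eq_le /Lpp; apply/andP; split.
  by apply: ge_sup => //; exists n%:R, s => //; rewrite ss.
apply: ub_le_sup; first by exists n%:R => x /Hub.
by exists s => //; rewrite ss.
Qed.

Lemma Lpp_chain N p q k : finite_set (N `&` hbox p q) ->
  chain N q k p <-> k%:R <= Lpp N p q.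
Proof. by move=> /LppP[n -> nP]; rewrite ler_nat. Qed.

Lemma eq_Lpp N N' p q p' q' :
  finite_set (N `&` hbox p q) -> finite_set (N' `&` hbox p' q') ->
  (forall k, chain N q k p <-> chain N' q' k p') -> Lpp N p q = Lpp N' p' q'.
Proof.
move=> /LppP[n -> nP] /LppP[n' -> n'P] h; congr (_%:R).
by apply/eqP; rewrite eqn_leq; apply/andP; split;
  [apply/n'P/h/nP|apply/nP/h/n'P].
Qed.

(* Whenever the first point of one of the two chains is not admissible for the
   other starting point, it is peeled off; once both are, swap the chains. *)
Lemma chain_cross N p1 p2 q1 q2 n m :
  p1.1 <= p2.1 -> p2.2 <= p1.2 -> q2.1 <= q1.1 -> q1.2 <= q2.2 ->
  p1.2 <= q1.2 -> p2.1 <= q2.1 ->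
  chain N q1 n p1 -> chain N q2 m p2 ->
  exists n' m', [/\ (n' + m' = n + m)%N, chain N q2 n' p1 & chain N q1 m' p2].
Proof.
have [l] := ubnP (n + m); elim: l n m p1 p2 => // l IH n m p1 p2 nml.
move=> P1 P2 Q1 Q2 A B c1 c2.
case: n c1 nml => [_|n [u [Nu [/andP[u1 u2] /andP[u3 u4]] cu]]] nml.
  case: m c2 nml => [_ _|m [v [Nv [/andP[v1 v2] /andP[v3 v4]] cv]] nml].
    by exists 0%N, 0%N.
  have [v5|v5] := leP v.2 p1.2; last first.
    exists m.+1, 0%N; split => //=; first by rewrite addn0.
    exists v; split => //; split; apply/andP; split => //.
    exact: le_lt_trans v1.
  have [||||||| n' [m' [e' c1' c2']]] := IH 0%N m p1 v _ _ _ _ _ _ _ I cv => //.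
  - by rewrite (le_trans P1)// ltW.
  - exists n', m'.+1; split => //; first by rewrite addnS e'.
    exists v; split => //; split; apply/andP; split => //.
      exact: le_trans Q1.
    exact: le_trans A.
have [u5|u5] := leP u.1 p2.1.
  have [||||||| n' [m' [e' c1' c2']]] := IH n m u p2 _ _ _ _ _ _ _ cu c2 => //.
  - by rewrite (le_trans P2)// ltW.
  - exists n'.+1, m'; split => //; first by rewrite addSn e'.
    exists u; split => //; split; apply/andP; split => //.
      exact: le_trans B.
    exact: le_trans Q2.
have hu : chain N q1 n.+1 p2.
  exists u; split => //; split; apply/andP; split => //.
  exact: le_lt_trans u3.
have hu1 : chain N q1 n.+1 p1.
  by exists u; split => //; split; apply/andP.
case: m c2 nml => [_ nml|m [v [Nv [/andP[v1 v2] /andP[v3 v4]] cv]] nml].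
  by exists 0%N, n.+1; split => //; rewrite add0n addn0.
have [v5|v5] := leP v.2 p1.2.
  have [||||||| n' [m' [e' c1' c2']]] :=
      IH n.+1 m p1 v _ _ _ _ _ _ _ hu1 cv => //.
  - by rewrite -addnS.
  - by rewrite (le_trans P1)// ltW.
  - exists n', m'.+1; split => //; first by rewrite addnS e' addnS.
    exists v; split => //; split; apply/andP; split => //.
      exact: le_trans Q1.
    exact: le_trans A.
exists m.+1, n.+1; split => //; first by rewrite addnC.
exists v; split => //; split; apply/andP; split => //.
exact: le_lt_trans v1.
Qed.

(** The two optimal chains on the left-hand side must cross; exchanging their ends by [chain_cross]
    keeps the total length and produces competitors for the right-hand side. *)
Lemma Lpp_cross N (x1 x2 y X Y1 Y2 : R) :
  finite_set (N `&` hbox (x1, y) (X, Y2)) ->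
  x1 <= x2 -> x2 <= X -> y <= Y1 -> Y1 <= Y2 ->
  Lpp N (x1, y) (X, Y1) + Lpp N (x2, y) (X, Y2) <=
  Lpp N (x1, y) (X, Y2) + Lpp N (x2, y) (X, Y1).
Proof.
move=> fN x12 x2X yY1 Y12.
have fsub a Y : x1 <= a -> Y <= Y2 -> finite_set (N `&` hbox (a, y) (X, Y)).
  move=> xa Y2'; apply: sub_finite_set fN => u [Nu [/= /andP[h1 h2] /andP[h3 h4]]].
  by split => //; split; apply/andP; split => /=; lra.
have [n En nP] := LppP (fsub x1 Y1 (lexx _) Y12).
have [m Em mP] := LppP (fsub x2 Y2 x12 (lexx _)).
have [|||||| n' [m' [e c1 c2]]] := @chain_cross N (x1, y) (x2, y) (X, Y1) (X, Y2) n m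
  _ _ _ _ _ _ ((nP n).2 (leqnn _)) ((mP m).2 (leqnn _)) => //.
rewrite En Em -natrD -e natrD lerD//.
  by apply/Lpp_chain => //; exact: fsub.
by apply/Lpp_chain => //; exact: fsub.
Qed.

(** Cut after the last point of height at most [y]; [x] is the abscissa of that point, or [p.1] if
    there is none. *)
Lemma chain_split N q k p y : p.1 <= q.1 -> p.2 <= y -> chain N q k p ->
  exists k1 k2 x, [/\ (k = k1 + k2)%N, p.1 <= x <= q.1,
    chain N (x, y) k1 p & chain N q k2 (x, y)].
Proof.
elim: k p => [|k IH] p pq py /=.
  by exists 0%N, 0%N, p.1; rewrite lexx pq.
move=> [u [Nu pqu cu]]; have [/= /andP[h1 h2] /andP[h3 h4]] := pqu.
have [uy|uy] := leP u.2 y.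
  have [k1 [k2 [x [-> /andP[h5 h6] c1 c2]]]] := IH u h2 uy cu.
  exists k1.+1, k2, x; split => //; first by rewrite h6 andbT; lra.
  by exists u; split => //; split => /=; apply/andP; split.
exists 0%N, k.+1, p.1; split => //; first by rewrite lexx.
by exists u; split => //; split => /=; apply/andP; split.
Qed.

End chains.

(** * Discretisation of a configuration on a fine grid *)

Section grid.
Context {R : realType}.
Implicit Types (N : set (R * R)) (Nu : set R) (p q u v : R * R).

Definition loc_fin1 Nu := forall A, bounded1 A -> finite_set (Nu `&` A).
Definition loc_fin2 N := forall B, bounded2 B -> finite_set (N `&` B).

Lemma bounded1_itv (a b : R) : bounded1 `]a, b]%classic.
Proof.
exists (`|a| + `|b|) => x /=; rewrite in_itv/= => /andP[ax xb].
rewrite ler_norml; have := ler_norm b; have := ler_norm (- a).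
have := normr_ge0 a; have := normr_ge0 b; rewrite normrN.
by move=> *; apply/andP; split; lra.
Qed.

Lemma bounded2_hbox p q : bounded2 (hbox p q).
Proof.
have [M1 h1] := bounded1_itv p.1 q.1; have [M2 h2] := bounded1_itv p.2 q.2.
exists (Num.max M1 M2) => x [x1 x2]; split; rewrite le_max.
  by rewrite h1//= in_itv.
by rewrite orbC h2//= in_itv.
Qed.

Lemma fin_itv Nu a b : loc_fin1 Nu -> finite_set (Nu `&` `]a, b]).
Proof. by move=> h; apply/h/bounded1_itv. Qed.

Lemma fin_hbox N p q : loc_fin2 N -> finite_set (N `&` hbox p q).
Proof. by move=> h; apply/h/bounded2_hbox. Qed.

Lemma npts_itvD Nu a b c : loc_fin1 Nu -> a <= b -> b <= c ->
  npts (Nu `&` `]a, c]) = (npts (Nu `&` `]a, b]) + npts (Nu `&` `]b, c]))%N.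
Proof.
move=> lf ab bc; rewrite -npts_disjU; [|exact: fin_itv..|].
  rewrite -setIUr; congr (npts (_ `&` _)); rewrite -itv_bndbnd_setU//.
apply/seteqP; split => // x [[_ /=]]; rewrite in_itv/= => /andP[_ h1] [_ /=].
by rewrite in_itv/= => /andP[h2 _]; lra.
Qed.

Lemma nu1_diff Nu a b : loc_fin1 Nu -> a <= b ->
  nu1 Nu b = nu1 Nu a + (npts (Nu `&` `]a, b]))%:R.
Proof.
move=> lf ab; rewrite /nu1; have [a0|a0] := leP 0 a.
  by rewrite (le_trans a0 ab) -natrD -npts_itvD.
have [b0|b0] := leP 0 b.
  by rewrite (@npts_itvD Nu a 0 b)// ?(ltW a0)// natrD; lra.
by rewrite (@npts_itvD Nu a b 0)// ?(ltW b0)// natrD; lra.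
Qed.

Lemma gap_seq (s : seq R) :
  exists2 d : R, 0 < d & forall a, a \in s -> 0 < a -> d < a.
Proof.
elim: s => [|x s [d d0 dP]]; first by exists 1.
have [x0|x0] := leP x 0.
  by exists d => // a; rewrite inE => /predU1P[->|/dP//]; lra.
exists (Num.min d (x / 2)); first by rewrite lt_min d0 divr_gt0.
move=> a; rewrite inE gt_min => /predU1P[->|/dP h] a0.
  by apply/orP; right; lra.
by rewrite h.
Qed.

Lemma finite_gap (A : set R) : finite_set A ->
  exists2 d : R, 0 < d & forall a b, A a -> A b -> a < b -> d < b - a.
Proof.
move=> /finite_seqP[s ->].
have [d d0 dP] := gap_seq [seq b - a | a <- s, b <- s].
exists d => // a b /= sa sb ab; apply: dP; last by lra.
by apply/allpairsP; exists (a, b).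
Qed.

Lemma grid_index (z0 eta x : R) (m : nat) : z0 < x -> x <= z0 + m%:R * eta ->
  exists i : nat, [/\ (i < m)%N, z0 + i%:R * eta < x & x <= z0 + i.+1%:R * eta].
Proof.
elim: m => [|m IH] zx; first by rewrite mul0r addr0 leNgt zx.
have [xm _|xm xm1] := leP x (z0 + m%:R * eta).
  have [i [im h1 h2]] := IH zx xm; exists i; split => //.
  exact: ltn_trans im _.
by exists m; split.
Qed.

(* Counts of [Nu] in [n] consecutive intervals and of [N] in the [m * m] cells of
   a grid; cell number [k] lies in column [k %% m] and row [k %/ m]. *)
Definition config_type n m : countType :=
  ({ffun 'I_n -> nat} * {ffun 'I_(m * m) -> nat})%type.

Definition cell (z0 eta h : R) m (k : 'I_(m * m)) : set (R * R) :=
  hbox (z0 + (k %% m)%N%:R * eta, (k %/ m)%N%:R * h)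
       (z0 + (k %% m).+1%:R * eta, (k %/ m).+1%:R * h).

Definition config N Nu (z0 eta h : R) n m : config_type n m :=
  ([ffun i : 'I_n => npts (Nu `&` `]z0 + i%:R * eta, z0 + i.+1%:R * eta])],
   [ffun k => npts (N `&` @cell z0 eta h m k)]).

(** Each cell is represented by its upper right corner: as boxes are open on the left, a box
    starting at column [j] then contains exactly the columns of index at least [j], and row 0 lies
    above height 0. *)
Definition cell_pt m (k : 'I_(m * m)) : R * R :=
  ((k %% m).+1%:R, (k %/ m).+1%:R).

Definition occupied m (y : {ffun 'I_(m * m) -> nat}) : set (R * R) :=
  [set v | exists2 k, (0 < y k)%N & v = cell_pt k].

(* The discrete counterpart of [profile], in the coordinates of the grid so that
   it is one and the same function for all tilts. *)
Definition score n m (x : config_type n m) (j : nat) : R :=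
  (\sum_(i < n | (i < j)%N) x.1 i)%:R
  + Lpp (occupied x.2) (j%:R, 0) (m%:R, m%:R).

Definition profile N Nu (z0 t tau z : R) : R :=
  (npts (Nu `&` `]z0, z]))%:R + Lpp N (z, 0) (t, tau).

Lemma finite_occupied m (y : {ffun 'I_(m * m) -> nat}) A :
  finite_set (occupied y `&` A).
Proof.
apply: (@sub_finite_set _ _ [set cell_pt k | k in [set: 'I_(m * m)]]).
  by move=> v [[k yk ->] _]; exists k.
by apply: finite_image; exact: finite_finset.
Qed.

Lemma cell_ord (a eta x y : R) (i j : nat) : 0 < eta ->
  a + i%:R * eta < x -> x <= a + i.+1%:R * eta ->
  a + j%:R * eta < y -> y <= a + j.+1%:R * eta ->
  ((i < j)%N -> x < y) /\ (eta < y - x -> (i < j)%N).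
Proof.
move=> e0 h1 h2 h3 h4; split => [ij|xy].
  apply: (le_lt_trans h2); apply: le_lt_trans h3.
  by rewrite lerD2l ler_wpM2r ?ler_nat// ltW.
rewrite -(ltr_nat R) -(ltr_pM2r e0).
have -> : i%:R * eta = i.+1%:R * eta - eta by rewrite -natr1; ring.
have : j%:R * eta = j.+1%:R * eta - eta by rewrite -natr1; ring.
lra.
Qed.

(** When distinct coordinates differ by more than the mesh, a cell holds at most one point and cells
    are ordered as the points in them, so continuous and discrete chains correspond. *)
Lemma score_config N Nu (z0 eta h : R) n m j :
  loc_fin2 N -> loc_fin1 Nu -> 0 < eta -> 0 < h -> (n <= m)%N -> (j <= n)%N ->
  let t := z0 + m%:R * eta in let tau := m%:R * h in
  (forall u v, (N `&` hbox (z0, 0) (t, tau)) u ->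
     (N `&` hbox (z0, 0) (t, tau)) v ->
     (u.1 < v.1 -> eta < v.1 - u.1) /\ (u.2 < v.2 -> h < v.2 - u.2)) ->
  score (config N Nu z0 eta h n m) j = profile N Nu z0 t tau (z0 + j%:R * eta).
Proof.
move=> lf2 lf1 e0 h0 nm jn t tau sep; rewrite /score /profile; congr (_%:R + _).
  pose F i := npts (Nu `&` `]z0 + i%:R * eta, z0 + i.+1%:R * eta]).
  under eq_bigr do rewrite ffunE.
  rewrite -(big_ord_widen _ F jn); elim: j {jn} => [|j IH].
    by rewrite big_ord0 mul0r addr0 set_itvoc0 setI0 /npts fset_set0 cardfs0.
  rewrite big_ord_recr/= IH -npts_itvD//.
    by rewrite lerDl mulr_ge0// ltW.
  by rewrite lerD2l ler_wpM2r ?ler_nat// ltW.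
set y := (config _ _ _ _ _ _ _).2.
pose inc (u : R * R) i r := [/\ z0 + i%:R * eta < u.1,
  u.1 <= z0 + i.+1%:R * eta, r%:R * h < u.2 & u.2 <= r.+1%:R * h].
have incP u : hbox (z0, 0) (t, tau) u ->
    exists i r, [/\ (i < m)%N, (r < m)%N & inc u i r].
  case=> /= /andP[u1 u2] /andP[u3 u4].
  have [i [im h1 h2]] := grid_index u1 u2.
  have [|r [rm h3 h4]] := @grid_index 0 h u.2 m u3; first by rewrite add0r.
  by rewrite !add0r in h3 h4; exists i, r; split.
have occP v : occupied y v <-> exists u i r,
    [/\ N u, (i < m)%N, (r < m)%N, inc u i r & v = (i.+1%:R, r.+1%:R)].
  split=> [[k]|[u [i [r [Nu' im rm [h1 h2 h3 h4] ->]]]]].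
    rewrite ffunE npts_gt0; last exact: fin_hbox.
    move=> [u [Nu' [/= /andP[h1 h2] /andP[h3 h4]]]] ->.
    have m0 : (0 < m)%N by have := ltn_ord k; move: (k : nat) => l; case: (m).
    exists u, (k %% m)%N, (k %/ m)%N; split => //; first by rewrite ltn_mod.
    by rewrite ltn_divLR.
  have km : (r * m + i < m * m)%N by nia.
  have m0 : (0 < m)%N by exact: leq_ltn_trans im.
  have E1 : ((r * m + i) %% m)%N = i by rewrite modnMDl modn_small.
  have E2 : ((r * m + i) %/ m)%N = r by rewrite divnMDl// divn_small// addn0.
  exists (Ordinal km); last by rewrite /cell_pt /= E1 E2.
  rewrite ffunE npts_gt0; last exact: fin_hbox.
  exists u; split => //; rewrite /cell /hbox /= E1 E2 h1 h2.
  by split => //; rewrite h3 h4.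
have fN p q : finite_set (N `&` hbox p q) by exact: fin_hbox.
have big u a b : z0 <= a -> 0 <= b -> hbox (a, b) (t, tau) u ->
    hbox (z0, 0) (t, tau) u.
  move=> za b0 [/= /andP[h1 h2] /andP[h3 h4]].
  by split; apply/andP; split => //=; lra.
have zj : z0 <= z0 + j%:R * eta by rewrite lerDl mulr_ge0// ltW.
have incm u i r : inc u i r -> (i < m)%N -> (r < m)%N ->
    hbox (z0, 0) (t, tau) u.
  move=> [h1 h2 h3 h4] im rm; split; apply/andP; split => /=.
  - by apply: le_lt_trans h1; rewrite lerDl mulr_ge0// ltW.
  - by apply: le_trans h2 _; rewrite lerD2l ler_wpM2r ?ler_nat// ltW.
  - by apply: le_lt_trans h3; rewrite mulr_ge0// ltW.
  - by apply: le_trans h4 _; rewrite ler_wpM2r ?ler_nat// ltW.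
(* The separation hypothesis enters here: comparing cell indices amounts to comparing
   coordinates. *)
have inclt u v i r i' r' : N u -> N v -> hbox (z0, 0) (t, tau) u ->
    hbox (z0, 0) (t, tau) v -> inc u i r -> inc v i' r' ->
    (u.1 < v.1 <-> (i < i')%N) /\ (u.2 < v.2 <-> (r < r')%N).
  move=> Nu' Nv bu bv [h1 h2 h3 h4] [g1 g2 g3 g4].
  have [s1 s2] := sep u v (conj Nu' bu) (conj Nv bv).
  have [c1 c2] := cell_ord e0 h1 h2 g1 g2.
  have [||||c3 c4] := @cell_ord 0 h u.2 v.2 r r' h0; rewrite ?add0r//.
  by split; split => //; [move/s1|move/s2].
apply: eq_Lpp => //; first exact: finite_occupied.
move=> k; split.
(* From the grid to the plane: whatever lies in a cell beyond [p] is itself beyond [p']. *)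
- pose S' (p p' : R * R) := forall u i r, N u -> hbox (z0, 0) (t, tau) u ->
    inc u i r -> (p.1 < i.+1%:R -> p'.1 < u.1) /\ (p.2 < r.+1%:R -> p'.2 < u.2).
  apply: (@chain_sim _ _ _ _ _ S').
    move=> p p' v Spp' /occP[u [i [r [Nu' im rm iu ->]]]].
    move=> [/= /andP[h1 h2] /andP[h3 h4]].
    have bu := incm _ _ _ iu im rm.
    have [s1 s2] := Spp' u i r Nu' bu iu.
    exists u; split => //.
      have [/= /andP[_ h5] /andP[_ h6]] := bu.
      by split; apply/andP; split; rewrite ?s1 ?s2.
    move=> w i' r' Nw bw iw /=; rewrite !ltr_nat !ltnS.
    by have [e1 e2] := inclt _ _ _ _ _ _ Nu' Nw bu bw iu iw; split=> [/e1|/e2].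
  move=> u i r Nu' bu [h1 h2 h3 h4] /=; split; last first.
    by move=> _; apply: le_lt_trans h3; rewrite mulr_ge0// ltW.
  rewrite ltr_nat ltnS => ji; apply: le_lt_trans h1.
  by rewrite lerD2l ler_wpM2r ?ler_nat// ltW.
(* From the plane to the grid; the two bounds on [p] keep the next point inside the large box, where
   separation is known. *)
pose S (p p' : R * R) := z0 <= p.1 /\ 0 <= p.2 /\
  forall u i r, N u -> hbox (z0, 0) (t, tau) u ->
    inc u i r -> (p.1 < u.1 -> p'.1 < i.+1%:R) /\ (p.2 < u.2 -> p'.2 < r.+1%:R).
apply: (@chain_sim _ _ _ _ _ S).
  move=> p p' u [p1 [p2 Spp']] Nu' pu.
  have bu : hbox (z0, 0) (t, tau) u by apply: big pu.
  have [i [r [im rm iu]]] := incP u bu.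
  have [s1 s2] := Spp' u i r Nu' bu iu.
  case: pu => /= /andP[h1 h2] /andP[h3 h4].
  exists (i.+1%:R, r.+1%:R); split.
  - by apply/occP; exists u, i, r.
  - by split; apply/andP; split; rewrite /= ?s1 ?s2 ?ler_nat.
  - split; first by lra.
    split; first by lra.
    move=> w i' r' Nw bw iw /=; rewrite !ltr_nat !ltnS.
    by have [e1 e2] := inclt _ _ _ _ _ _ Nu' Nw bu bw iu iw; split=> [/e1|/e2].
split => //; split => // u i r Nu' bu [h1 h2 h3 h4] /=; split=> [ju|_]; last first.
  by rewrite ltr0n.
rewrite ltr_nat ltnS leqNgt; apply/negP => ij.
have := le_lt_trans h2; have : i.+1%:R * eta <= j%:R * eta.
  by rewrite ler_wpM2r ?ler_nat// ltW.
lra.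
Qed.

End grid.

(** * Maximisers in a window, their discretisation and their tilts *)

Section peaks.
Context {R : realType}.
Implicit Types (N : set (R * R)) (Nu : set R).

(** The only abscissae at which [profile] can change its value, by [profile_const]. *)
Definition jumps N Nu (z0 t tau : R) : set R :=
  [set u.1 | u in N `&` hbox (z0, 0) (t, tau)] `|` (Nu `&` `]z0, t]).

Lemma finite_jumps N Nu z0 t tau : loc_fin2 N -> loc_fin1 Nu ->
  finite_set (jumps N Nu z0 t tau).
Proof.
move=> lf2 lf1; rewrite /jumps finite_setU; split; last exact: fin_itv.
by apply: finite_image; exact: fin_hbox.
Qed.

Lemma profile_const N Nu z0 t tau z z' : z0 <= z -> z <= z' -> z' <= t ->
  (forall a, jumps N Nu z0 t tau a -> ~ (z < a <= z')) ->
  profile N Nu z0 t tau z = profile N Nu z0 t tau z'.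
Proof.
move=> z0z zz' z't noj; rewrite /profile; congr ((npts _)%:R + _).
  apply/seteqP; split=> x [Nx /=]; rewrite in_itv/= => /andP[h1 h2].
    by split => //=; rewrite in_itv/= h1 (le_trans h2).
  split => //=; rewrite in_itv/= h1 leNgt; apply/negP => zx.
  apply: (noj x); last by rewrite zx h2.
  by right; split => //=; rewrite in_itv/= h1 (le_trans h2).
rewrite /Lpp; congr sup.
suff -> : N `&` hbox (z, 0) (t, tau) = N `&` hbox (z', 0) (t, tau) by [].
apply/seteqP; split=> u [Nu' [/= /andP[h1 h2] /andP[h3 h4]]]; split => //.
  split; rewrite /= ?h2 ?h3 ?h4//= andbT ltNge; apply/negP => uz.
  apply: (noj u.1); last by rewrite h1.
  left; exists u => //; split => //; split; rewrite /= ?h3 ?h4 ?h2// andbT.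
  exact: le_lt_trans h1.
by split; rewrite /= ?h2 ?h3 ?h4//= andbT (le_lt_trans zz').
Qed.

(** Eventually the mesh is smaller than every gap between jumps, between points of [A], and between
    heights of points. The set [A] will hold the ends of the target window, so that passing to a
    grid point does not change membership in it. *)
Lemma grid_approx N Nu z0 t tau (A : set R) :
  loc_fin2 N -> loc_fin1 Nu -> z0 < t -> 0 < tau -> finite_set A ->
  \forall m \near \oo, [/\ (0 < m)%N,
    forall n j, (n <= m)%N -> (j <= n)%N ->
      score (config N Nu z0 ((t - z0) / m%:R) (tau / m%:R) n m) j =
      profile N Nu z0 t tau (z0 + j%:R * ((t - z0) / m%:R)) &
    forall z, z0 <= z < t -> exists j, [/\ (j <= m)%N,
      z0 + j%:R * ((t - z0) / m%:R) <= z + (t - z0) / m%:R,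
      profile N Nu z0 t tau (z0 + j%:R * ((t - z0) / m%:R)) =
        profile N Nu z0 t tau z &
      forall a, A a -> (a <= z0 + j%:R * ((t - z0) / m%:R)) = (a <= z)]].
Proof.
move=> lf2 lf1 z0t tau0 fA.
have [|d1 d10 d1P] := @finite_gap _ (jumps N Nu z0 t tau `|` A).
  by rewrite finite_setU; split => //; exact: finite_jumps.
have [|d2 d20 d2P] := @finite_gap _ [set u.2 | u in N `&` hbox (z0, 0) (t, tau)].
  by apply: finite_image; exact: fin_hbox.
near=> m.
have m0 : (0 < m)%N by near: m; exact: nbhs_infty_gt.
have m0' : m%:R != 0 :> R by rewrite pnatr_eq0 -lt0n.
have m0R : 0 < m%:R :> R by rewrite ltr0n.
have small x d : 0 < d -> x / d < m%:R -> x / m%:R < d :> R.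
  by move=> d0; rewrite !ltr_pdivrMr// mulrC.
have e1 : (t - z0) / m%:R < d1.
  by apply: small d10 _; near: m; exact: nbhs_infty_gtr.
have e2 : tau / m%:R < d2.
  by apply: small d20 _; near: m; exact: nbhs_infty_gtr.
set eta := (t - z0) / m%:R; rewrite -/eta in e1.
have eta0 : 0 < eta by rewrite divr_gt0// subr_gt0.
have Et : z0 + m%:R * eta = t by rewrite /eta mulrC divfK// addrC subrK.
have Etau : m%:R * (tau / m%:R) = tau by rewrite mulrC divfK.
split => // [n j nm jn|z /andP[z0z zt]].
  rewrite score_config// ?Et ?Etau ?divr_gt0//.
  move=> u v hu hv; split => huv.
    by apply: lt_trans e1 _; apply: d1P => //; left; left; [exists u|exists v].
  by apply: lt_trans e2 _; apply: d2P => //; [exists u|exists v].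
have [j [jm h1 h2]] : exists j, [/\ (j < m)%N, z0 + j%:R * eta <= z &
    z < z0 + j.+1%:R * eta].
  have g0 : 0 <= (z - z0) / eta by rewrite divr_ge0 ?(ltW eta0) ?subr_ge0.
  have /andP[h1 h2] := truncn_itv g0.
  have h3 : z0 + (Num.truncn ((z - z0) / eta))%:R * eta <= z.
    by rewrite addrC -lerBrDr -ler_pdivlMr.
  exists (Num.truncn ((z - z0) / eta)); split => //.
    rewrite -(ltr_nat R) -(ltr_pM2r eta0) -(ltrD2l z0) Et.
    exact: le_lt_trans h3 zt.
  by rewrite addrC -ltrBlDr -ltr_pdivrMr.
have Ej : z0 + j.+1%:R * eta = z0 + j%:R * eta + eta by rewrite -natr1; ring.
(* Of the two grid points around [z], one is reached without meeting a jump or a point of [A]: if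
   there is one between [z] and the right neighbour, then the gap excludes another between the left
   neighbour and [z]. *)
have [[a [Ja /andP[za aj]]]|noj] := pselect
    (exists a, (jumps N Nu z0 t tau `|` A) a /\ z < a <= z0 + j.+1%:R * eta).
  have noj a' : (jumps N Nu z0 t tau `|` A) a' ->
      z0 + j%:R * eta < a' -> a' <= z -> False.
    by move=> Ja' h3 h4; have := d1P a' a Ja' Ja (le_lt_trans h4 za); lra.
  exists j; split; [exact: ltnW|lra| |].
    apply: profile_const => //; [by rewrite lerDl mulr_ge0// ltW|exact: ltW|].
    by move=> x Jx /andP[h3 h4]; apply: (noj x) => //; left.
  move=> x Ax; apply/idP/idP => h; first exact: le_trans h1.
  by rewrite leNgt; apply/negP => h3; apply: (noj x) => //; right.
exists j.+1; split => //; first by lra.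
  apply/esym/profile_const => //; [exact: ltW| |].
    by rewrite -Et lerD2l ler_wpM2r ?ler_nat// ltW.
  by move=> x Jx h; apply: noj; exists x; split => //; left.
move=> x Ax; apply/idP/idP => h; last by apply: (le_trans h); exact: ltW.
by rewrite leNgt; apply/negP => h3; apply: noj; exists x; split; [right|rewrite h3].
Unshelve. all: end_near. Qed.

(** Ties are tolerated except to the right of the window. This agrees with [Z1] being the supremum
    of the maximisers, and it supplies the strict inequality that makes peaks of different tilts
    incompatible. *)
Definition peak (b c eta : R) n m (x : config_type n m) : Prop :=
  exists j, [/\ (j <= n)%N, - c <= - b + j%:R * eta < c &
    forall i, (i <= n)%N -> score x i <= score x j :> R /\
      (c <= - b + i%:R * eta -> score x i < score x j :> R)].

(** The dilation of ratio [lam] about [t]; for [lam > 1] it moves the window around 0 to the left by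
    about [(lam - 1) * t]. *)
Definition tilt (lam t z : R) : R := t + lam * (z - t).

Definition tilted_profile N Nu (lam t b z : R) : R :=
  profile N Nu (tilt lam t (- b)) t (t / lam) (tilt lam t z).

(** The range of competitors has a variable right end because discretising costs some room: a peak
    up to [t] yields a discrete peak, which yields back a peak only up to some [b' < b]. *)
Definition cont_peak N Nu (lam t b c top : R) : Prop :=
  exists2 z, - c <= z < c &
    forall z', - b <= z' <= top ->
      tilted_profile N Nu lam t b z' <= tilted_profile N Nu lam t b z /\
      (c <= z' ->
       tilted_profile N Nu lam t b z' < tilted_profile N Nu lam t b z).

Definition mesh (t b : R) (m : nat) : R := (t + b) / m%:R.

(** Before tilting, the [m] columns cover [[-b, t]], while [Nu] is recorded only on the columns
    inside [[-b, b]]; this short window keeps the change of intensity cheap. *)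
Definition ncols (t b : R) m : nat := Num.truncn (2 * b / mesh t b m).

Lemma ncols_itv (t b : R) m : 0 < b -> 0 < t -> (0 < m)%N ->
  (ncols t b m)%:R * mesh t b m <= 2 * b < (ncols t b m)%:R * mesh t b m + mesh t b m.
Proof.
move=> b0 t0 m0; have e0 : 0 < mesh t b m.
  by rewrite divr_gt0 ?ltr0n// addr_gt0.
have g0 : 0 <= 2 * b / mesh t b m by apply: divr_ge0; [lra|exact: ltW].
have /andP[h1 h2] := truncn_itv g0; apply/andP; split.
  by rewrite -ler_pdivlMr.
by rewrite -[X in _ + X]mul1r -mulrDl natr1 -ltr_pdivrMr.
Qed.

Lemma ncols_le (t b : R) m : 0 < b -> b <= t -> (0 < m)%N -> (ncols t b m <= m)%N.
Proof.
move=> b0 bt m0; have t0 : 0 < t by exact: lt_le_trans bt.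
have e0 : 0 < mesh t b m by rewrite divr_gt0 ?ltr0n// addr_gt0.
have /andP[h1 _] := ncols_itv b0 t0 m0.
rewrite -(ler_nat R) -(ler_pM2r e0); apply: (le_trans h1).
have -> : m%:R * mesh t b m = t + b.
  by rewrite /mesh mulrC divfK// pnatr_eq0 -lt0n.
lra.
Qed.

Definition tilted_config N Nu (lam t b : R) m : config_type (ncols t b m) m :=
  config N Nu (tilt lam t (- b)) (lam * mesh t b m) (t / lam / m%:R) (ncols t b m) m.

Lemma peak_approx N Nu lam t b b' c : loc_fin2 N -> loc_fin1 Nu ->
  0 < lam -> 0 < c -> c < b' -> b' < b -> b <= t ->
  \forall m \near \oo,
    (peak b c (mesh t b m) (tilted_config N Nu lam t b m) ->
       cont_peak N Nu lam t b c b') /\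
    (cont_peak N Nu lam t b c t ->
       peak b c (mesh t b m) (tilted_config N Nu lam t b m)).
Proof.
move=> lf2 lf1 l0 c0 cb' b'b bt.
have b0 : 0 < b by lra.
have t0 : 0 < t by lra.
have E : t - tilt lam t (- b) = lam * (t + b) by rewrite /tilt; ring.
have le_tilt x y : (tilt lam t x <= tilt lam t y) = (x <= y).
  by rewrite /tilt lerD2l ler_pM2l// lerD2r.
have lt_tilt x y : (tilt lam t x < tilt lam t y) = (x < y).
  by rewrite /tilt ltrD2l ltr_pM2l// ltrD2r.
have tiltt : tilt lam t t = t by rewrite /tilt subrr mulr0 addr0.
have z0t : tilt lam t (- b) < t by rewrite -[ltRHS]tiltt lt_tilt; lra.
have := grid_approx lf2 lf1 z0t (divr_gt0 t0 l0)
  (finite_set2 (tilt lam t (- c)) (tilt lam t c)).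
apply: filter_app; near=> m.
rewrite E -mulrA -/(mesh t b m) => -[m0 sc rep].
have e0 : 0 < mesh t b m by rewrite divr_gt0 ?ltr0n//; lra.
have Em : m%:R * mesh t b m = t + b.
  by rewrite /mesh mulrC divfK// pnatr_eq0 -lt0n.
have nm : (ncols t b m <= m)%N by exact: ncols_le.
(* The representative of a point may lie one mesh to its right; this margin keeps those of points
   below [b'] within the recorded columns. *)
have e1 : mesh t b m < (b - b') / 2.
  rewrite /mesh ltr_pdivrMr ?ltr0n// mulrC -ltr_pdivrMr ?divr_gt0 ?subr_gt0//.
  by near: m; exact: nbhs_infty_gtr.
have /andP[n1 n2] := ncols_itv b0 t0 m0.
have zj j : tilt lam t (- b) + j%:R * (lam * mesh t b m) =
    tilt lam t (- b + j%:R * mesh t b m) by rewrite /tilt; ring.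
have sc' j : (j <= ncols t b m)%N -> score (tilted_config N Nu lam t b m) j =
    tilted_profile N Nu lam t b (- b + j%:R * mesh t b m).
  by move=> jn; rewrite /tilted_config /tilted_profile -zj -(sc _ _ nm).
have rep' z : - b <= z <= b' -> exists j, [/\ (j <= ncols t b m)%N,
    tilted_profile N Nu lam t b (- b + j%:R * mesh t b m) =
      tilted_profile N Nu lam t b z,
    (- c <= - b + j%:R * mesh t b m) = (- c <= z) &
    (c <= - b + j%:R * mesh t b m) = (c <= z)].
  move=> /andP[bz zb'].
  have [|j [jm h1 h2 h3]] := rep (tilt lam t z).
    by rewrite le_tilt bz -[ltRHS]tiltt lt_tilt; lra.
  exists j; split.
  - rewrite zj /tilt in h1.
    have {h1} : lam * (- b + j%:R * mesh t b m) <= lam * (z + mesh t b m) by lra.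
    rewrite ler_pM2l// => h1.
    rewrite leqNgt; apply/negP => nj.
    have : (ncols t b m)%:R * mesh t b m + mesh t b m <= j%:R * mesh t b m.
      by rewrite -[X in _ + X]mul1r -mulrDl natr1 ler_pM2r// ler_nat.
    lra.
  - by rewrite /tilted_profile -h2 zj.
  - by rewrite -le_tilt -zj h3 ?le_tilt//; left.
  - by rewrite -le_tilt -zj h3 ?le_tilt//; right.
split.
  move=> [j [jn jc jmax]]; exists (- b + j%:R * mesh t b m) => // z' z'b.
  have [i [ilen <- _ ic]] := rep' z' z'b.
  have [h1 h2] := jmax i ilen; rewrite -sc'// -sc'//.
  by split => //; rewrite -ic.
move=> [z /andP[cz zc] zmax].
have [|j [jn jE j1 j2]] := rep' z; first by apply/andP; split; lra.
exists j; split => //; first by rewrite j1 cz ltNge j2 -ltNge.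
move=> i ilen; rewrite !sc'// jE.
have ib : i%:R * mesh t b m <= 2 * b.
  by apply: le_trans n1; rewrite ler_pM2r// ler_nat.
apply: zmax; rewrite lerDl mulr_ge0 ?(ltW e0)//=; lra.
Unshelve. all: end_near. Qed.

(* Lowering the end point from [(t, t / lam1)] to [(t, t / lam2)] can only move
   the maximiser to the right, whereas the tilt moves the window to the left. *)
Lemma cont_peak_disjoint N Nu lam1 lam2 t b c top : loc_fin2 N -> loc_fin1 Nu ->
  0 < lam1 -> 0 < c -> 0 < t -> lam1 < lam2 ->
  top <= t -> (lam1 + lam2) * c <= (lam2 - lam1) * t ->
  lam2 * t + lam1 * c <= lam1 * t + lam2 * top ->
  (lam2 - lam1) * t + lam2 * c <= lam1 * b ->
  cont_peak N Nu lam1 t b c top -> cont_peak N Nu lam2 t b c top -> False.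
Proof.
move=> lf2 lf1 l0 c0 t0 l12 topt d1 d2 d3.
have l20 : 0 < lam2 by lra.
move=> [z1 /andP[z1c z1c'] max1] [z2 /andP[z2c z2c'] max2].
have M1 : lam1 * - c <= lam1 * z1 by rewrite ler_pM2l.
have M1' : lam1 * z1 < lam1 * c by rewrite ltr_pM2l.
have M2 : lam2 * - c <= lam2 * z2 by rewrite ler_pM2l.
have M2' : lam2 * z2 < lam2 * c by rewrite ltr_pM2l.
pose x1 := tilt lam1 t z1; pose x2 := tilt lam2 t z2.
(* [y1] and [y2] are the two maximisers, each read in the coordinates of the other tilt; the
   numerical hypotheses place both within the competitors and [y2] to the right of the window. *)
pose y1 := t + (x2 - t) / lam1; pose y2 := t + (x1 - t) / lam2.
have Ey1 : tilt lam1 t y1 = x2 by rewrite /tilt /y1; field; rewrite gt_eqF.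
have Ey2 : tilt lam2 t y2 = x1 by rewrite /tilt /y2; field; rewrite gt_eqF.
have F1 : lam1 * y1 = lam1 * t + lam2 * z2 - lam2 * t.
  by move: Ey1; rewrite /x2 /tilt; lra.
have F2 : lam2 * y2 = lam2 * t + lam1 * z1 - lam1 * t.
  by move: Ey2; rewrite /x1 /tilt; lra.
have x12 : x2 <= x1 by rewrite /x1 /x2 /tilt; lra.
have B1 : - b <= y1 <= top.
  apply/andP; split; rewrite -(ler_pM2l l0) F1; first by lra.
  have : lam1 * c <= lam1 * top.
    have : lam2 * (t - top) <= lam1 * (t - c) by lra.
    have : lam1 * (t - top) <= lam2 * (t - top).
      by rewrite ler_wpM2r ?subr_ge0// ltW.
    lra.
  nra.
have B2 : - b <= y2 <= top.
  apply/andP; split; rewrite -(ler_pM2l l20) F2; last by lra.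
  nra.
have C2 : c <= y2 by rewrite -(ler_pM2l l20) F2; lra.
have [P1 _] := max1 _ B1; have [_ /(_ C2) P2] := max2 _ B2.
move: P1 P2; rewrite /tilted_profile Ey1 Ey2 -/x1 -/x2 /profile.
have x2t : x1 <= t by rewrite /x1 /tilt; nra.
have e1 : tilt lam1 t (- b) <= x2 by rewrite /x2 /tilt; lra.
have e2 : tilt lam2 t (- b) <= x2 by rewrite /x2 /tilt; nra.
(* Both comparisons involve the same count of [Nu] on []x2, x1]]. It cancels in their sum, leaving
   the strict reverse of [Lpp_cross]. *)
rewrite (@npts_itvD _ _ _ x2 x1 lf1 e1 x12) (@npts_itvD _ _ _ x2 x1 lf1 e2 x12).
have := @Lpp_cross _ N x2 x1 0 t (t / lam2) (t / lam1) (fin_hbox _ _ lf2) x12 x2t.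
have -> : 0 <= t / lam2 by rewrite divr_ge0 ?ltW.
have -> : t / lam2 <= t / lam1 by rewrite ler_pM2l// lef_pV2 ?posrE// ltW.
move=> /(_ isT isT); rewrite !natrD; lra.
Qed.

End peaks.

(** * Laws of countably valued variables *)

Section discrete_laws.
Context {R : realType} {d : measure_display} {Omega : measurableType d}.
Variable P : probability Omega R.
Local Open Scope ereal_scope.

Section countable.
Context {T : countType}.
Implicit Types (X Y : Omega -> T) (Q : T -> Prop).

(** Coding values by integers turns an event about [X] into a disjoint union of a sequence. *)
Let atom X Q (n : nat) : set Omega := [set w | choice.pickle (X w) = n /\ Q (X w)].

Let atomE X Q n : atom X Q n =
  if pickle_inv n is Some x then
    if `[< Q x >] then [set w | X w = x] else set0 else set0.
Proof.
rewrite /atom; case E : (pickle_inv n) => [x|].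
  have nE : choice.pickle x = n by have := @pickle_invK T n; rewrite E.
  apply/seteqP; split=> w /=.
    move=> [Xn QX]; have XE : X w = x.
      by apply: (pcan_inj (@pickleK_inv T)); rewrite Xn nE.
    by rewrite -XE; case: asboolP.
  by case: asboolP => //= Qx ->; split.
rewrite -subset0 => w /= [Xn _].
by move: E; rewrite -Xn pickleK_inv.
Qed.

Let atom_bigcup X Q : [set w | Q (X w)] = \bigcup_n atom X Q n.
Proof.
apply/seteqP; split=> w /=; first by exists (choice.pickle (X w)).
by move=> [n _ []].
Qed.

Let measurable_atom X Q n : (forall x, measurable [set w | X w = x]) ->
  measurable (atom X Q n).
Proof. by rewrite atomE => mX; case: pickle_inv => // x; case: ifP. Qed.

Lemma measurable_countable X Q : (forall x, measurable [set w | X w = x]) ->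
  measurable [set w | Q (X w)].
Proof.
by move=> mX; rewrite atom_bigcup; apply: bigcup_measurable => n _;
  exact: measurable_atom.
Qed.

Definition mass X Q (n : nat) : \bar R :=
  if pickle_inv n is Some x then
    if `[< Q x >] then P [set w | X w = x] else 0 else 0.

Lemma mass_ge0 X Q n : 0 <= mass X Q n.
Proof. by rewrite /mass; case: pickle_inv => // x; case: ifP. Qed.

Lemma countable_law X Q : (forall x, measurable [set w | X w = x]) ->
  P [set w | Q (X w)] = \sum_(n <oo) mass X Q n.
Proof.
move=> mX; rewrite atom_bigcup measure_bigcup//; first last.
- by move=> i j _ _ [w [[<- _] [<- _]]].
- by move=> n _; exact: measurable_atom.
rewrite (eq_eseriesl (Q := xpredT)); last by move=> n; rewrite in_setT.
apply: eq_eseriesr => n _; rewrite atomE /mass.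
by case: pickle_inv => [x|]; [case: ifP => //|]; rewrite measure0.
Qed.

(** Sum the domination of point masses over the values in [Q], and bound the probability for [Z] by
    1. *)
Lemma countable_domination X Y Z Q (a b : R) : (0 <= a)%R -> (0 <= b)%R ->
  (forall x, measurable [set w | X w = x]) ->
  (forall x, measurable [set w | Y w = x]) ->
  (forall x, measurable [set w | Z w = x]) ->
  (forall x, P [set w | X w = x] <=
    a%:E * P [set w | Y w = x] + b%:E * P [set w | Z w = x]) ->
  P [set w | Q (X w)] <= a%:E * P [set w | Q (Y w)] + b%:E.
Proof.
move=> a0 b0 mX mY mZ XYZ.
apply: (@le_trans _ _ (a%:E * P [set w | Q (Y w)] + b%:E * P [set w | Q (Z w)])).
  rewrite !countable_law//.
  rewrite -nneseriesZl; last by move=> n _; exact: mass_ge0.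
  rewrite -nneseriesZl; last by move=> n _; exact: mass_ge0.
  rewrite -nneseriesD; [|by move=> *; rewrite mule_ge0// mass_ge0..].
  apply: lee_nneseries => n _; [by move=> _; exact: mass_ge0|].
  rewrite /mass; case: pickle_inv => [x|]; last by rewrite !mule0 adde0.
  by case: ifP => // _; rewrite !mule0 adde0.
rewrite leeD2l// -[leRHS]mule1 lee_wpmul2l ?lee_fin//.
by apply: probability_le1; exact: measurable_countable.
Qed.

End countable.

(* Chernoff's bound: [kap * th ^+ j] dominates the indicator of [Q]. *)
Lemma poisson_chernoff (X : Omega -> nat) (mu th kap : R) (Q : nat -> Prop) :
  (0 <= mu)%R -> (0 <= th)%R -> (0 <= kap)%R ->
  (forall k, measurable [set w | X w = k]) ->
  (forall k, P [set w | X w = k] = (poisson_law mu k)%:E) ->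
  (forall k, Q k -> (1 <= kap * th ^+ k)%R) ->
  P [set w | Q (X w)] <= (kap * expR (mu * (th - 1)))%:E.
Proof.
move=> mu0 th0 kap0 mX PX kapP; rewrite countable_law//.
have E0 n : (0 <= exp_coeff (th * mu) n :> R)%R.
  by rewrite /exp_coeff divr_ge0 ?ler0n// exprn_ge0// mulr_ge0.
apply: (@le_trans _ _ (\sum_(n <oo) (kap * expR (- mu))%:E *
    (exp_coeff (th * mu) n)%:E)).
  apply: lee_nneseries => n _; [by move=> _; exact: mass_ge0|].
  have h0 : 0 <= (kap * expR (- mu))%:E * (exp_coeff (th * mu) n)%:E.
    by rewrite -EFinM lee_fin mulr_ge0// mulr_ge0// expR_ge0.
  rewrite /mass; case E : (pickle_inv n) => [x|//].
  have <- : x = n by have := @pickle_invK nat n; rewrite E.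
  case: asboolP => [Qx|_]; last first.
    by rewrite -EFinM lee_fin mulr_ge0// mulr_ge0// expR_ge0.
  rewrite PX -EFinM lee_fin /poisson_law /exp_coeff /=.
  have h : (0 <= mu ^+ x / x`!%:R * expR (- mu) :> R)%R.
    by rewrite mulr_ge0 ?expR_ge0// divr_ge0 ?ler0n// exprn_ge0.
  rewrite -[leLHS]mul1r; apply: (le_trans (ler_wpM2r h (kapP _ Qx))).
  by rewrite exprMn le_eqVlt; apply/orP; left; apply/eqP; ring.
rewrite nneseriesZl; last by move=> n _; rewrite lee_fin.
have -> : (mu * (th - 1) = - mu + th * mu)%R by ring.
rewrite expRD mulrA [leRHS]EFinM; apply: lee_wpmul2l.
  by rewrite lee_fin mulr_ge0// expR_ge0.
have cv : (\sum_(0 <= k < n) (exp_coeff (th * mu)%R k)%:E)%R @[n --> \oo] -->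
    (expR (th * mu))%:E.
  under eq_fun do rewrite sumEFin.
  apply: cvg_EFin; first by near=> n.
  have := @is_cvg_series_exp_coeff R (th * mu); rewrite /expR => h.
  exact: h.
by rewrite (cvg_lim _ cv).
Unshelve. all: end_near. Qed.

End discrete_laws.

(** * Law of the grid counts and change of intensity *)

Section grid_law.
Context {R : realType} {d : measure_display} {Omega : measurableType d}.
Variable P : probability Omega R.
Variables (Pts : Omega -> set (R * R)) (Nu : Omega -> set R).
Hypothesis HS : hammersley_setting P Pts Nu.

Lemma setting_fin2 w : loc_fin2 (Pts w).
Proof. by move=> B; case: HS => _ + _ _; exact. Qed.

Lemma setting_fin1 w : loc_fin1 (Nu w).
Proof. by move=> B; case: HS => _ _ + _; exact. Qed.

Lemma hboxE (p q : R * R) :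
  hbox p q = `]p.1, q.1]%classic `*` `]p.2, q.2]%classic.
Proof. by apply/seteqP; split=> u; rewrite /hbox /= !in_itv. Qed.

Lemma measurable_hbox (p q : R * R) : measurable (hbox p q).
Proof. by rewrite hboxE; apply: measurableX; exact: measurable_itv. Qed.

Lemma lebesgue_itv (a b : R) : a <= b ->
  @lebesgue_measure R `]a, b]%classic = (b - a)%:E.
Proof.
move=> ab; rewrite lebesgue_measure_itv/= lte_fin; case: ltP => // ba.
by have -> : b - a = 0 by lra.
Qed.

Lemma lebesgue2_hbox (p q : R * R) : p.1 <= q.1 -> p.2 <= q.2 ->
  lebesgue2 (hbox p q) = ((q.1 - p.1) * (q.2 - p.2))%:E.
Proof.
move=> h1 h2; rewrite hboxE /lebesgue2 product_measure1E//.
rewrite -[LHS]/(@lebesgue_measure R `]p.1, q.1]%classic *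
  @lebesgue_measure R `]p.2, q.2]%classic)%E.
by rewrite !lebesgue_itv.
Qed.

Lemma hbox_half (p q : R * R) : 0 <= p.2 -> hbox p q `<=` upper_half.
Proof. by move=> p0 u [_ /andP[h _]]; exact: le_lt_trans h. Qed.

Lemma setting_hbox (p q : R * R) k : 0 <= p.2 -> p.1 <= q.1 -> p.2 <= q.2 ->
  measurable [set w | npts (Pts w `&` hbox p q) = k] /\
  P [set w | npts (Pts w `&` hbox p q) = k] =
    (poisson_law ((q.1 - p.1) * (q.2 - p.2)) k)%:E.
Proof.
move=> p0 h1 h2; case: HS => _ _ _ [+ _ _].
move=> /(_ (hbox p q) k (measurable_hbox p q) (bounded2_hbox p q)).
by rewrite lebesgue2_hbox//; apply; exact: hbox_half.
Qed.

Lemma setting_itv (a b : R) k : a <= b ->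
  measurable [set w | npts (Nu w `&` `]a, b]) = k] /\
  P [set w | npts (Nu w `&` `]a, b]) = k] = (poisson_law (b - a) k)%:E.
Proof.
move=> ab; case: HS => _ _ _ [_ + _].
move=> /(_ `]a, b]%classic k (measurable_itv _) (bounded1_itv a b)).
by rewrite lebesgue_itv.
Qed.

(** Half-open columns and cells are pairwise disjoint, so the independence rule of the setting
    applies. The law sees the cells only through their area [eta * h]. *)
Lemma config_law (z0 eta h : R) n m (x : config_type n m) : 0 < eta -> 0 < h ->
  measurable [set w | config (Pts w) (Nu w) z0 eta h n m = x] /\
  P [set w | config (Pts w) (Nu w) z0 eta h n m = x] =
    ((\prod_(i < n) poisson_law eta (x.1 i)) *
     (\prod_(k < m * m) poisson_law (eta * h) (x.2 k)))%:E.
Proof.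
move=> e0 h0.
pose I (i : 'I_n) := `]z0 + i%:R * eta, z0 + i.+1%:R * eta]%classic.
have Ilen (i : nat) : z0 + i%:R * eta <= z0 + i.+1%:R * eta.
  by rewrite lerD2l ler_wpM2r ?ler_nat// ltW.
have Jlen (i : nat) : i%:R * h <= i.+1%:R * h.
  by rewrite ler_wpM2r ?ler_nat// ltW.
have ediff (a : R) (i : nat) : a + i.+1%:R * eta - (a + i%:R * eta) = eta.
  by rewrite -natr1; ring.
have hdiff (i : nat) : i.+1%:R * h - i%:R * h = h by rewrite -natr1; ring.
have E : [set w | config (Pts w) (Nu w) z0 eta h n m = x] =
    \big[setI/setT]_(k < m * m) [set w | npts (Pts w `&` @cell _ z0 eta h m k) = x.2 k]
    `&` \big[setI/setT]_(i < n) [set w | npts (Nu w `&` I i) = x.1 i].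
  apply/seteqP; split=> w /=.
    by move=> <-; split; rewrite -bigcap_seq => i _ /=; rewrite ffunE.
  rewrite -!bigcap_seq => -[h1 h2]; case: x h1 h2 => x y /= h1 h2.
  congr pair; apply/ffunP => i; rewrite ffunE.
    by apply: h2; rewrite /= mem_index_enum.
  by apply: h1; rewrite /= mem_index_enum.
have r0 (k : 'I_(m * m)) : 0 <= (k %/ m)%N%:R * h by rewrite mulr_ge0// ltW.
have LB (k : 'I_(m * m)) := @setting_hbox
  (z0 + (k %% m)%N%:R * eta, (k %/ m)%N%:R * h)
  (z0 + (k %% m).+1%:R * eta, (k %/ m).+1%:R * h) (x.2 k)
  (r0 k) (Ilen (k %% m)%N) (Jlen (k %/ m)%N).
have LI i := setting_itv (x.1 i) (Ilen i).
split.
  rewrite E; apply: measurableI; apply: bigsetI_measurable => i _.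
    exact: (LB i).1.
  exact: (LI i).1.
rewrite E; case: HS => _ _ _ [_ _ ->].
- rewrite -[in RHS]mulrC EFinM -!prodEFin; congr (_ * _)%E; apply: eq_bigr => i _.
    by rewrite (LB i).2 /= ediff hdiff.
  by rewrite (LI i).2 ediff.
- move=> k; split; [exact: measurable_hbox|exact: bounded2_hbox|].
  by apply: hbox_half; exact: r0.
- by move=> i; split; [exact: measurable_itv|exact: bounded1_itv].
- move=> k k' kk'; rewrite -subset0 => u [].
  move=> [/= /andP[a1 a2] /andP[a3 a4]] [/= /andP[b1 b2] /andP[b3 b4]].
  have m0 : (0 < m)%N by have := ltn_ord k; move: (k : nat) => l; case: (m).
  have c1 : (k %% m = k' %% m)%N.
    have [|lt1|lt1//] := ltngtP (k %% m)%N (k' %% m)%N.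
      by move=> /((cell_ord e0 a1 a2 b1 b2).1); rewrite ltxx.
    by have := (cell_ord e0 b1 b2 a1 a2).1 lt1; rewrite ltxx.
  have c2 : (k %/ m = k' %/ m)%N.
    rewrite -[X in X < _]add0r in a3; rewrite -[X in _ <= X]add0r in a4.
    rewrite -[X in X < _]add0r in b3; rewrite -[X in _ <= X]add0r in b4.
    have [|lt1|lt1//] := ltngtP (k %/ m)%N (k' %/ m)%N.
      by move=> /((cell_ord h0 a3 a4 b3 b4).1); rewrite ltxx.
    by have := (cell_ord h0 b3 b4 a3 a4).1 lt1; rewrite ltxx.
  move/eqP : kk'; apply; apply: val_inj => /=.
  by rewrite (divn_eq k m) (divn_eq k' m) c1 c2.
- move=> i i' ii'; rewrite -subset0 => u []; rewrite /I /= !in_itv /=.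
  move=> /andP[a1 a2] /andP[b1 b2].
  move/eqP : ii'; apply; apply: val_inj => /=.
  have [|lt1|lt1//] := ltngtP i i'.
    by move=> /((cell_ord e0 a1 a2 b1 b2).1); rewrite ltxx.
  by have := (cell_ord e0 b1 b2 a1 a2).1 lt1; rewrite ltxx.
Qed.

Lemma poisson_law_ge0 (r : R) k : 0 <= r -> 0 <= poisson_law r k.
Proof.
move=> r0; rewrite /poisson_law mulr_ge0 ?expR_ge0// divr_ge0 ?ler0n//.
exact: exprn_ge0.
Qed.

(** The factor is the density of the Poisson process of intensity [lam] with respect to that of
    intensity 1 on a window of length [n * eta]. *)
Lemma prod_poisson_scale (lam eta : R) n (f : 'I_n -> nat) :
  \prod_(i < n) poisson_law (lam * eta) (f i) =
  (lam ^+ (\sum_(i < n) f i)) * expR (- ((lam - 1) * (n%:R * eta))) *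
  \prod_(i < n) poisson_law eta (f i).
Proof.
elim: n f => [|n IH] f.
  by rewrite !big_ord0 expr0 mul0r mulr0 oppr0 expR0 !mul1r.
rewrite !big_ord_recr/= IH exprD /poisson_law exprMn.
have -> : expR (- (lam * eta)) = expR (- ((lam - 1) * eta)) * expR (- eta).
  by rewrite -expRD; congr expR; ring.
have -> : expR (- ((lam - 1) * (n.+1%:R * eta))) =
    expR (- ((lam - 1) * (n%:R * eta))) * expR (- ((lam - 1) * eta)).
  by rewrite -expRD; congr expR; rewrite -natr1; ring.
ring.
Qed.

(* Up to a constant, the Poisson law of intensity [1] is the geometric mean of
   those of intensities [lam] and [lam^-1]; apply the AM-GM inequality. *)
Lemma prod_poisson_le (lam eta kap a : R) n (f : 'I_n -> nat) :
  0 < lam -> 0 < eta -> 0 < a ->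
  (lam + lam^-1 - 2) * (n%:R * eta) <= 2 * kap ->
  \prod_(i < n) poisson_law eta (f i) <=
  expR kap * a * \prod_(i < n) poisson_law (lam * eta) (f i) +
  expR kap / a * \prod_(i < n) poisson_law (lam^-1 * eta) (f i).
Proof.
move=> l0 e0 a0 hk; rewrite !prod_poisson_scale.
set p := \prod_(i < n) _; set s := (\sum_(i < n) _)%N.
have p0 : 0 <= p by apply: prodr_ge0 => i _; exact/poisson_law_ge0/ltW.
set A := lam ^+ s * _; set B := lam^-1 ^+ s * _.
have A0 : 0 < A by rewrite mulr_gt0 ?exprn_gt0 ?expR_gt0.
have B0 : 0 < B by rewrite mulr_gt0 ?exprn_gt0 ?expR_gt0 ?invr_gt0.
have AB : expR (- (2 * kap)) <= A * B.
  have -> : A * B = expR (- ((lam + lam^-1 - 2) * (n%:R * eta))).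
    rewrite /A /B mulrACA -exprMn divff ?gt_eqF// expr1n mul1r -expRD.
    by congr expR; ring.
  by rewrite ler_expR lerN2.
suff h : 1 <= expR kap * a * A + expR kap / a * B.
  have := ler_wpM2r p0 h; rewrite mul1r mulrDl !mulrA.
  by [].
set x := expR kap * a * A; set y := expR kap / a * B.
have k0 := expR_gt0 kap.
have x0 : 0 < x by exact: mulr_gt0 (mulr_gt0 k0 a0) A0.
have y0 : 0 < y by exact: mulr_gt0 (divr_gt0 k0 a0) B0.
have xy : 1 <= x * y.
  have -> : x * y = expR (2 * kap) * (A * B).
    have -> : 2 * kap = kap + kap by ring.
    by rewrite expRD /x /y; field; rewrite gt_eqF.
  by rewrite -[leLHS]expR0 -(subrr (2 * kap)) expRD ler_pM2l ?expR_gt0.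
nra.
Qed.

Lemma measurable_tilted lam t b m (Q : config_type (ncols t b m) m -> Prop) :
  0 < lam -> 0 < b -> 0 < t -> (0 < m)%N ->
  measurable [set w | Q (tilted_config (Pts w) (Nu w) lam t b m)].
Proof.
move=> l0 b0 t0 m0; have e0 : 0 < mesh t b m.
  by rewrite divr_gt0 ?ltr0n// addr_gt0.
have h0 : 0 < t / lam / m%:R by rewrite !divr_gt0 ?ltr0n.
by apply: measurable_countable => x; exact: (config_law _ x (mulr_gt0 l0 e0) h0).1.
Qed.

(** Tilting preserves the area of cells, so the factor of [Pts] is the same for the tilts [1], [lam]
    and [lam^-1]; only the column counts of [Nu] differ, on a length at most [2 * b], and
    [prod_poisson_le] compares them. *)
Lemma tilted_domination lam t b kap a m (Q : config_type (ncols t b m) m -> Prop) :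
  0 < lam -> 0 < b -> 0 < t -> 0 < a -> (0 < m)%N ->
  (lam + lam^-1 - 2) * b <= kap ->
  (P [set w | Q (tilted_config (Pts w) (Nu w) 1 t b m)] <=
   (expR kap * a)%:E * P [set w | Q (tilted_config (Pts w) (Nu w) lam t b m)]
   + (expR kap / a)%:E)%E.
Proof.
move=> l0 b0 t0 a0 m0 hk; have e0 : 0 < mesh t b m.
  by rewrite divr_gt0 ?ltr0n// addr_gt0.
have law l x : 0 < l ->
    measurable [set w | tilted_config (Pts w) (Nu w) l t b m = x] /\
    P [set w | tilted_config (Pts w) (Nu w) l t b m = x] =
    ((\prod_(i < ncols t b m) poisson_law (l * mesh t b m) (x.1 i)) *
     (\prod_(k < m * m) poisson_law (mesh t b m * (t / m%:R)) (x.2 k)))%:E.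
  move=> l1; have h0 : 0 < t / l / m%:R by rewrite !divr_gt0 ?ltr0n.
  have [m1 ->] := config_law (tilt l t (- b)) x (mulr_gt0 l1 e0) h0.
  split => //; congr ((_ * _)%:E); apply: eq_bigr => k _; congr poisson_law.
  by field; rewrite !gt_eqF ?ltr0n.
have l1 : 0 < lam^-1 by rewrite invr_gt0.
apply: (@countable_domination _ _ _ _ _ _ _
  (fun w => tilted_config (Pts w) (Nu w) lam^-1 t b m)).
- by rewrite mulr_ge0 ?expR_ge0// ltW.
- by rewrite divr_ge0 ?expR_ge0// ltW.
- by move=> x; case: (law 1 x).
- by move=> x; case: (law lam x).
- by move=> x; case: (law lam^-1 x).
move=> x; rewrite (law 1 x _).2// (law lam x _).2// (law lam^-1 x _).2//.
rewrite -!EFinM -EFinD lee_fin mul1r.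
set q := \prod_(k < m * m) _; have q0 : 0 <= q.
  apply: prodr_ge0 => i _; apply: poisson_law_ge0.
  by apply: mulr_ge0; [exact: ltW|rewrite divr_ge0 ?ler0n// ltW].
rewrite ![_ * (_ * q)]mulrA -mulrDl ler_wpM2r//.
apply: prod_poisson_le => //.
have [h1 h2] := andP (ncols_itv b0 t0 m0).
have g0 : 0 <= lam + lam^-1 - 2.
  have : 0 <= lam^-1 * (lam - 1) ^+ 2 by rewrite mulr_ge0 ?sqr_ge0// ltW.
  have -> : lam^-1 * (lam - 1) ^+ 2 = lam + lam^-1 - 2.
    by field; rewrite gt_eqF.
  by [].
have := ler_wpM2l g0 h1; lra.
Qed.

End grid_law.

(** * Vanishing and almost disjoint events *)

Section almost_disjoint.
Context {R : realType} {d : measure_display} {Omega : measurableType d}.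
Variable P : probability Omega R.
Local Open Scope ereal_scope.

(** No outcome lies in infinitely many [F m], so the decreasing tail unions have empty intersection
    and their probabilities tend to 0. *)
Lemma eventually_null (F : nat -> set Omega) :
  (forall m, measurable (F m)) ->
  (forall w, \forall m \near \oo, ~ F m w) ->
  forall e : R, (0 < e)%R -> exists m, P (F m) <= e%:E.
Proof.
move=> mF evF e e0.
have mT : measurable (\bigcup_(k in [set k | (0 <= k)%N]) F k).
  by apply: bigcup_measurable => k _.
have := @lim_sup_set_cvg _ _ _ P F mF
  (le_lt_trans (probability_le1 _ mT) (ltry 1)).
have -> : lim_sup_set F = set0.
  rewrite -subset0 => w h; have [n _ Hn] := evF w.
  by have [m /= nm Fm] := h n I; exact: Hn nm Fm.
rewrite measure0 => /fine_cvgP[_].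
move=> /cvgrPdist_le /(_ _ e0)[m _ /(_ m (leqnn m))] /=.
rewrite sub0r normrN => h; exists m.
set G := \bigcup_(k in [set k | (m <= k)%N]) F k in h.
have mG : measurable G by apply: bigcup_measurable => k _.
apply: (@le_trans _ _ (P G)).
  by apply: le_measure; rewrite ?inE// => w Fw; exists m => /=.
rewrite -(fineK (fin_num_measure P _ mG)) lee_fin.
exact: le_trans (ler_norm _) h.
Qed.

(** Removing [B] makes the events disjoint, at a cost of at most [P B] each. *)
Lemma sum_almost_disjoint n (F : 'I_n -> set Omega) (B : set Omega) :
  (forall i, measurable (F i)) -> measurable B ->
  (forall i j, i != j -> F i `&` F j `<=` B) ->
  \sum_(i < n) P (F i) <= 1 + n%:R%:E * P B.
Proof.
move=> mF mB FB.
have mD i : measurable (F i `\` B) by exact: measurableD.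
apply: (@le_trans _ _ (\sum_(i < n) (P (F i `\` B) + P B))).
  apply: lee_sum => i _.
  apply: (@le_trans _ _ (P ((F i `\` B) `|` B))).
    apply: le_measure; rewrite ?inE//; first exact: measurableU.
    by move=> w Fw; have [Bw|Bw] := pselect (B w); [right|left].
  exact: measureU2.
rewrite big_split/= leeD//.
  rewrite -measure_bigsetU_ord//.
    by apply: probability_le1; apply: bigsetU_measurable.
  apply/trivIsetP => i j _ _ ij; rewrite -subset0 => w [[Fi nB] [Fj _]].
  by apply: nB; apply: (FB i j).
rewrite -(fineK (fin_num_measure P _ mB)) sumEFin sumr_const card_ord.
by rewrite -[(fine _ *+ n)%R]mulr_natl EFinM.
Qed.

End almost_disjoint.

(** * Averaging over the tilts *)

Section main_bound.
Context {R : realType} {d : measure_display} {Omega : measurableType d}.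
Variable P : probability Omega R.
Variables (Pts : Omega -> set (R * R)) (Nu : Omega -> set R).
Hypothesis HS : hammersley_setting P Pts Nu.

(** Here [u] stands for [t^(1/3)]. With a measurable [E] inside the continuous event, apart from [E]
    only grid events have to be measured. *)
Lemma cont_peak_bound (u a : R) (K : nat) (E : set Omega) :
  8 <= u -> 0 < a -> (0 < K)%N -> measurable E ->
  E `<=` [set w | cont_peak (Pts w) (Nu w) 1 (u ^+ 3) (8 * u ^+ 2)
                    (u ^+ 2 / K%:R) (u ^+ 3)] ->
  (P E <= (expR 128 * (a / K%:R + a^-1))%:E)%E.
Proof.
move=> u8 a0 K0 mE subE.
(* Transported maximisers stray by at most [(lam - 1) t + lam c <= 4 u^2 + 3/2 u^2], which fits in
   [[-8 u^2, 7 u^2]]; [u >= 8] gives [b <= t]. *)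
set t := u ^+ 3; set c := u ^+ 2 / K%:R; set b := 8 * u ^+ 2.
set b' := 7 * u ^+ 2.
have u0 : 0 < u by lra.
have K0R : 0 < K%:R :> R by rewrite ltr0n.
have K1R : 1 <= K%:R :> R by rewrite ler1n.
have s0 : 0 < u ^+ 2 by rewrite exprn_gt0.
have Et : t = u * u ^+ 2 by rewrite /t exprS.
have c0 : 0 < c by rewrite divr_gt0.
have Kc : K%:R * c = u ^+ 2 by rewrite /c mulrC divfK// gt_eqF.
have cs : c <= u ^+ 2 by rewrite -Kc ler_peMl// ltW.
have b0 : 0 < b by rewrite mulr_gt0.
have t0 : 0 < t by rewrite exprn_gt0.
have bt : b <= t by rewrite Et /b ler_pM2r.
have b'b : b' < b by rewrite /b /b'; lra.
have cb' : c < b' by rewrite /b'; lra.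
(* Successive tilts displace the window by [4 * c], and the tilted half-widths add up to at most
   [3 * c], as all [lam k] with [k < K] are at most [3/2]. *)
pose lam (k : nat) : R := 1 + 4 * k%:R * c / t.
have lamt k : (lam k - 1) * t = 4 * k%:R * c.
  by rewrite /lam addrAC subrr add0r divfK// gt_eqF.
have lam1 k : 1 <= lam k.
  rewrite /lam lerDl; apply: divr_ge0 (ltW t0).
  by apply: mulr_ge0 (ltW c0); rewrite mulr_ge0.
have lam0 k : 0 < lam k by exact: lt_le_trans (lam1 k).
have lamK k : (k < K)%N -> (lam k - 1) * t <= 4 * u ^+ 2.
  move=> kK; rewrite lamt -Kc -mulrA ler_pM2l// ler_pM2r// ler_nat.
  exact: ltnW.
have lamu k : (k < K)%N -> lam k - 1 <= 4 / u.
  move=> /lamK; rewrite Et mulrA ler_pM2r// => h.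
  by rewrite ler_pdivlMr.
have u12 : 4 / u <= 1 / 2 by rewrite ler_pdivrMr//; lra.
(* The left factor is [(lam - 1)^2 / lam], at most [(4 / u)^2], and
   [(4 / u)^2 * (8 * u^2) = 128]. *)
have lamkap k : (k < K)%N -> (lam k + (lam k)^-1 - 2) * b <= 128.
  move=> kK; have h1 := lamu k kK; have h2 := lam1 k.
  apply: (@le_trans _ _ ((lam k - 1) ^+ 2 * b)).
    rewrite ler_pM2r//.
    have -> : lam k + (lam k)^-1 - 2 = (lam k - 1) ^+ 2 / lam k.
      by field; rewrite gt_eqF.
    by rewrite ler_pdivrMr// ler_peMr// sqr_ge0.
  have -> : 128 = (4 / u) ^+ 2 * b :> R by rewrite /b; field; rewrite gt_eqF.
  rewrite ler_pM2r// ler_sqr ?nnegrE ?divr_ge0 ?(ltW u0)// subr_ge0.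
  exact: lam1.
have disj k l w : (k < l)%N -> (l < K)%N ->
    cont_peak (Pts w) (Nu w) (lam k) t b c b' ->
    cont_peak (Pts w) (Nu w) (lam l) t b c b' -> False.
  move=> kl lK; have kK := ltn_trans kl lK.
  have h1 := lam1 k; have h2 := lam1 l; have h3 := lamu _ kK.
  have h4 := lamu _ lK; have h5 := lamK _ lK; have h6 := lamK _ kK.
  have h7 : 4 * c <= (lam l - lam k) * t.
    have -> : (lam l - lam k) * t = (lam l - 1) * t - (lam k - 1) * t by ring.
    rewrite !lamt -mulrBl -mulrBr -natrB ?(ltnW kl)// ler_pM2r//.
    by rewrite ler_peMr// ler1n subn_gt0.
  have h8 : lam k * c <= 3 / 2 * c by rewrite ler_pM2r//; lra.
  have h9 : lam l * c <= 3 / 2 * c by rewrite ler_pM2r//; lra.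
  have h10 : b' <= lam l * b' by rewrite ler_peMl// mulr_ge0// ltW.
  have h11 : b <= lam k * b by rewrite ler_peMl// ltW.
  have h12 : 0 <= (lam k - 1) * t by rewrite mulr_ge0 ?subr_ge0// ltW.
  apply: cont_peak_disjoint => //.
  - exact: setting_fin2 HS w.
  - exact: setting_fin1 HS w.
  - suff : 0 < (lam l - lam k) * t by rewrite pmulr_lgt0// subr_gt0.
    by apply: lt_le_trans h7; rewrite mulr_gt0.
  - exact: le_trans (ltW b'b) bt.
  - lra.
  - rewrite /b' in h10 *; lra.
  - rewrite /b in h11 *; lra.
pose kap : R := 128; rewrite -/kap.
have {}lamkap k : (k < K)%N -> (lam k + (lam k)^-1 - 2) * b <= kap by exact: lamkap.
clearbody kap.
pose Y l m := [set w | @peak R b c (mesh t b m.+1) _ _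
  (tilted_config (Pts w) (Nu w) l t b m.+1)].
have mY l m : 0 < l -> measurable (Y l m).
  by move=> l0; exact: (measurable_tilted HS).
have approx l w : 0 < l -> \forall m \near \oo,
    (Y l m w -> cont_peak (Pts w) (Nu w) l t b c b') /\
    (cont_peak (Pts w) (Nu w) l t b c t -> Y l m w).
  move=> l0; have [n _ Hn] := peak_approx (@setting_fin2 _ _ _ _ _ _ HS w)
    (@setting_fin1 _ _ _ _ _ _ HS w) l0 c0 cb' b'b bt.
  by exists n => // m /= nm; apply: Hn => /=; exact: leqW.
(* The outcomes where the grid is still too coarse: [E] is not detected, or two tilts peak together.
   Every outcome leaves [B m] eventually. *)
pose B m := (E `\` Y 1 m) `|` \big[setU/set0]_(kl : 'I_K * 'I_K | (kl.1 < kl.2)%N)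
  (Y (lam kl.1) m `&` Y (lam kl.2) m).
have mB m : measurable (B m).
  apply: measurableU; first by apply: measurableD => //; exact: mY.
  by apply: bigsetU_measurable => kl _; apply: measurableI; exact: mY.
have evB w : \forall m \near \oo, ~ B m w.
  have H : \forall m \near \oo, forall k : 'I_K, Y (lam k) m w ->
      cont_peak (Pts w) (Nu w) (lam k) t b c b'.
    apply: filter_forall => k; have := approx (lam k) w (lam0 k).
    by apply: filterS => m [].
  have := approx 1 w ltr01; apply: filter_app; move: H; apply: filter_app.
  near=> m => Hk [_ H1] [[Ew nY]|]; first by apply: nY; apply: H1; exact: subE.
  rewrite -bigcup_seq_cond => -[[k l] /= /andP[_ kl] [Yk Yl]].
  exact: (disj k l w kl (ltn_ord l) (Hk _ Yk) (Hk _ Yl)).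
apply/lee_addgt0Pr => e e0.
have A0 : 0 < 1 + expR kap * a by rewrite addr_gt0// mulr_gt0// expR_gt0.
(* [1 + expR kap * a] is the total weight of [P (B m)] in the final estimate. *)
have [m hm] := @eventually_null _ _ _ P _ mB evB _ (divr_gt0 e0 A0).
have fn A : measurable A -> P A = (fine (P A))%:E.
  by move=> mA; rewrite fineK// fin_num_measure.
have hE : (P E <= P (Y 1%R m) + P (B m))%E.
  apply: le_trans (measureU2 P (mY 1 m ltr01) (mB m)).
  apply: le_measure; rewrite ?inE//; first exact: measurableU (mY 1 m ltr01) (mB m).
  by move=> w Ew; have [Yw|Yw] := pselect (Y 1 m w); [left|right; left].
have hY (k : 'I_K) : (P (Y 1%R m) <=
    (expR kap * a)%:E * P (Y (lam k) m) + (expR kap / a)%:E)%E.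
  by apply: (tilted_domination HS) => //; exact: lamkap.
have hS : (\sum_(k < K) P (Y (lam k) m) <= 1 + K%:R%:E * P (B m))%E.
  apply: sum_almost_disjoint => //; first by move=> k; exact: mY.
  move=> k l kl w [Yk Yl]; right; rewrite -bigcup_seq_cond.
  have [kl'|kl'|/val_inj kl'] := ltngtP k l; last by rewrite kl' eqxx in kl.
    by exists (k, l) => //=; rewrite mem_index_enum.
  by exists (l, k) => //=; rewrite mem_index_enum.
have hS' : (\sum_(k < K) P (Y 1%R m) <=
    \sum_(k < K) ((expR kap * a)%:E * P (Y (lam k) m) + (expR kap / a)%:E))%E.
  by apply: lee_sum => k _; exact: hY.
move: hS; under eq_bigr do rewrite (fn _ (mY _ m (lam0 _))).
move=> hS; move: hS'.
under [X in (_ <= X)%E]eq_bigr do rewrite (fn _ (mY _ m (lam0 _))) -EFinM -EFinD.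
move=> hS'; move: hE hm hS hS'.
rewrite (fn _ (mY 1 m ltr01)) (fn _ (mB m)) (fn _ mE).
rewrite !sumEFin -!EFinM -!EFinD !lee_fin.
set pE := fine (P E); set pY := fine (P (Y 1%R m)); set pB := fine (P (B m)).
rewrite big_split/= -mulr_sumr !sumr_const card_ord.
set g := expR kap; rewrite -[pY *+ K]mulr_natl -[(g / a) *+ K]mulr_natl.
set S := \sum_(i < K) _.
have g0 : 0 < g by exact: expR_gt0.
move=> hE hm hS hS'.
have {hS hS'} : K%:R * pY <= g * a * (1 + K%:R * pB) + K%:R * (g / a).
  by apply: (le_trans hS'); rewrite lerD2r ler_pM2l// mulr_gt0.
move=> h; have hB : (1 + g * a) * pB <= e by rewrite mulrC -ler_pdivlMr.
have hB' : K%:R * ((1 + g * a) * pB) <= K%:R * e by rewrite ler_pM2l.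
have hE' : K%:R * pE <= K%:R * (pY + pB) by rewrite ler_pM2l.
have EK : K%:R * (g * (a / K%:R + a^-1) + e) = g * a + K%:R * (g / a) + K%:R * e.
  by field; rewrite !gt_eqF.
rewrite -(ler_pM2l K0R) EK.
lra.
Unshelve. all: end_near. Qed.

End main_bound.

(** * The exit point in terms of countably many heights *)

Section exit_point.
Context {R : realType}.
Implicit Types (N : set (R * R)) (Nu : set R).

Definition height N Nu (t z : R) : R := nu1 Nu z + Lpp N (z, 0) (t, t).

(** An enumeration of the rationals, capped at [t]: by [height_grid] these countably many positions
    realise every height. *)
Definition grid_pt (t : R) (n : nat) : R :=
  Num.min (ratr (odflt 0 (choice.unpickle n))) t.

(* In this case [L1] and [Z1] take junk values. *)
Definition heights_unbounded N Nu (t : R) : Prop :=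
  forall k : nat, exists n, k%:R < height N Nu t (grid_pt t n).

Definition maximal_at N Nu (t z : R) : Prop := L1 N Nu t t = height N Nu t z.

Lemma grid_pt_le t n : grid_pt t n <= t.
Proof. by rewrite ge_min lexx orbT. Qed.

Lemma height_profile N Nu t z z' : loc_fin1 Nu -> z <= z' ->
  height N Nu t z' = nu1 Nu z + profile N Nu z t t z'.
Proof. by move=> lf zz'; rewrite /height (nu1_diff lf zz') /profile addrA. Qed.

(** The height is constant from [z] up to the next jump. Adding [z] to the jumps makes the gap bound
    the distance from [z] to that jump. *)
Lemma height_grid N Nu t z e : loc_fin2 N -> loc_fin1 Nu -> z <= t -> 0 < e ->
  exists n, [/\ z <= grid_pt t n, grid_pt t n < z + e &
    height N Nu t (grid_pt t n) = height N Nu t z].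
Proof.
move=> lf2 lf1 zt e0.
have [|d d0 dP] := @finite_gap _ (jumps N Nu z t t `|` [set z]).
  by rewrite finite_setU; split => //; exact: finite_jumps.
have [q] : exists q : rat, z < ratr q < z + Num.min d e.
  have : z < z + Num.min d e by rewrite ltrDl lt_min d0.
  by move=> /rat_in_itvoo[q]; rewrite in_itv/=; exists q.
rewrite -ltrBlDl lt_min => /andP[zq /andP[qd qe]].
exists (choice.pickle q); rewrite /grid_pt choice.pickleK /=; split.
- by rewrite le_min zt (ltW zq).
- by rewrite gt_min; apply/orP; left; lra.
have zm : z <= Num.min (ratr q) t by rewrite le_min zt (ltW zq).
rewrite (height_profile _ _ lf1 zm) (height_profile _ _ lf1 (lexx z)).
congr (_ + _); apply/esym/profile_const => //; first by rewrite ge_min lexx orbT.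
move=> x Jx /andP[zx]; rewrite le_min => /andP[xq _].
have := dP z x (or_intror erefl) (or_introl Jx) zx; lra.
Qed.

Lemma height_int N Nu t z : loc_fin2 N ->
  exists i : int, height N Nu t z = i%:~R.
Proof.
move=> lf2; have [n En _] := LppP (fin_hbox (z, 0) (t, t) lf2).
rewrite /height En /nu1; case: ifP => _.
  by exists (addn (npts (Nu `&` `]0, z])) n)%:Z; rewrite -pmulrn natrD.
exists (n%:Z - (npts (Nu `&` `]z, 0]))%:Z).
by rewrite rmorphB /= -!pmulrn addrC.
Qed.

Lemma heights_bounded N Nu t : loc_fin2 N -> loc_fin1 Nu ->
  ~ heights_unbounded N Nu t ->
  exists M : R, forall z, z <= t -> height N Nu t z <= M.
Proof.
move=> lf2 lf1 /existsNP[k /forallNP Hk]; exists k%:R => z zt.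
have [n [_ _ <-]] := height_grid lf2 lf1 zt ltr01.
by rewrite leNgt; apply/negP; exact: Hk.
Qed.

Lemma L1_ub N Nu t : loc_fin2 N -> loc_fin1 Nu -> ~ heights_unbounded N Nu t ->
  forall z, z <= t -> height N Nu t z <= L1 N Nu t t.
Proof.
move=> lf2 lf1 /(heights_bounded lf2 lf1)[M HM] z zt.
apply: ub_le_sup; last by exists z.
by exists M => _ [x xt <-]; exact: HM.
Qed.

(** Heights are integers, so one within [1/2] of the finite supremum attains it. *)
Lemma maximal_ex N Nu t : loc_fin2 N -> loc_fin1 Nu ->
  ~ heights_unbounded N Nu t -> exists2 z, z <= t & maximal_at N Nu t z.
Proof.
move=> lf2 lf1 bd; have ub := L1_ub lf2 lf1 bd.
have hs : has_sup [set nu1 Nu z + Lpp N (z, 0) (t, t) | z in [set z | z <= t]].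
  split; first by exists (height N Nu t t), t => //=.
  by exists (L1 N Nu t t) => _ [z zt <-]; exact: ub.
have half0 : 0 < 2^-1 :> R by rewrite invr_gt0.
have [_ [z zt <-]] := sup_adherent half0 hs.
rewrite -/(L1 N Nu t t) -/(height N Nu t z) => Lz.
exists z => //; apply/eqP; rewrite eq_le ub// andbT; apply: ge_sup.
  by exists (height N Nu t t), t => //=.
move=> _ [z' z't <-]; rewrite -/(height N Nu t z').
have {Lz} : height N Nu t z' - 2^-1 < height N Nu t z.
  by apply: le_lt_trans Lz; rewrite lerD2r; exact: ub.
have [i ->] := height_int Nu t z' lf2; have [j ->] := height_int Nu t z lf2.
move=> h; rewrite ler_int leNgt; apply/negP => ji.
have : (j + 1 <= i)%R by lia.
by rewrite -(ler_int R) rmorphD /=; lra.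
Qed.

(** The second alternative is the unbounded case, where [L1] is the default value 0 of [sup] and
    being maximal means having height 0. *)
Lemma maximal_atE N Nu t n : loc_fin2 N -> loc_fin1 Nu ->
  maximal_at N Nu t (grid_pt t n) <->
  (forall n', height N Nu t (grid_pt t n') <= height N Nu t (grid_pt t n)) \/
  (heights_unbounded N Nu t /\ height N Nu t (grid_pt t n) = 0).
Proof.
move=> lf2 lf1; have [U|bd] := pselect (heights_unbounded N Nu t).
  have L0 : L1 N Nu t t = 0.
    apply: sup_out => -[_ [M HM]].
    have [n' hn'] := U (Num.truncn `|M|).+1.
    have := lt_trans (lt_le_trans (truncnS_gt `|M|) (ltW hn')) .
    have /HM := ex_intro2 (fun z => z <= t) (fun z => height N Nu t z = _)
      (grid_pt t n') (grid_pt_le t n') erefl.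
    have := truncnS_gt `|M|; have := ler_norm M; lra.
  rewrite /maximal_at L0; split=> [<-|]; first by right.
  move=> [h|[_ ->//]]; have [n' hn'] := U (Num.truncn `|height N Nu t (grid_pt t n)|).+1.
  have := h n'; have := truncnS_gt `|height N Nu t (grid_pt t n)|.
  have := ler_norm (height N Nu t (grid_pt t n)); lra.
have ub := L1_ub lf2 lf1 bd; split=> [E|[h|[//]]].
  by left=> n'; rewrite -E; apply: ub; exact: grid_pt_le.
apply/eqP; rewrite eq_le ub ?grid_pt_le// andbT; apply: ge_sup.
  by exists (height N Nu t t), t => //=.
move=> _ [z zt <-]; have [n' [_ _ E]] := height_grid lf2 lf1 zt ltr01.
by rewrite -/(height N Nu t z) -E.
Qed.

(** Each maximiser has a maximiser among the [grid_pt] at or to the right of it, so the supremum may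
    be taken over these. If there is none, [Z1] is the supremum of the empty set, which is 0 and
    lies in the interval. *)
Lemma exit_pointE N Nu t c : loc_fin2 N -> loc_fin1 Nu -> 0 <= c ->
  0 <= Z1 N Nu t t <= c <->
  (forall n, maximal_at N Nu t (grid_pt t n) -> grid_pt t n <= c) /\
  ((forall n, ~ maximal_at N Nu t (grid_pt t n)) \/
   (forall k : nat, exists n, maximal_at N Nu t (grid_pt t n) /\
      - k.+1%:R^-1 < grid_pt t n)).
Proof.
move=> lf2 lf1 c0; set S := [set z | z <= t /\ maximal_at N Nu t z].
have EZ : Z1 N Nu t t = sup S by [].
have repS z : S z -> exists2 n, z <= grid_pt t n & maximal_at N Nu t (grid_pt t n).
  move=> [zt mz]; have [n [h1 _ h2]] := height_grid lf2 lf1 zt ltr01.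
  by exists n => //; rewrite /maximal_at h2.
have grS n : maximal_at N Nu t (grid_pt t n) -> S (grid_pt t n).
  by move=> mn; split => //; exact: grid_pt_le.
have [[z0 Sz0]|S0] := pselect (S !=set0); last first.
  have -> : Z1 N Nu t t = 0.
    by rewrite EZ; have -> : S = set0 by [apply: contrapT => /eqP/set0P]; rewrite sup0.
  have nm n : ~ maximal_at N Nu t (grid_pt t n).
    by move=> /grS h; apply: S0; exists (grid_pt t n).
  by rewrite lexx c0; split => // _; split; [move=> n /nm|left].
have hS : has_sup S by split; [exists z0|exists t => z []].
have ubS z : S z -> z <= sup S by move=> Sz; apply: ub_le_sup => //; case: hS.
rewrite EZ; split.
  move=> /andP[S0 Sc]; split.
    by move=> n mn; apply: le_trans Sc; exact/ubS/grS.
  right=> k; have k0 : 0 < k.+1%:R^-1 :> R by rewrite invr_gt0.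
  have [z Sz h] := sup_adherent k0 hS; have [n zn mn] := repS z Sz.
  by exists n; split => //; move: (k.+1%:R^-1) h => x h; lra.
move=> [Hc H]; apply/andP; split; last first.
  apply: ge_sup; first by exists z0.
  by move=> z /repS[n zn /Hc]; exact: le_trans.
case: H => [H|H]; first by have [n _ /H] := repS z0 Sz0.
rewrite leNgt; apply/negP => s0.
have [n [mn]] := H (Num.truncn (- sup S)^-1).
have h1 := ubS _ (grS _ mn); move=> h2.
have h3 : (- sup S)^-1 < (Num.truncn (- sup S)^-1).+1%:R by exact: truncnS_gt.
have : (Num.truncn (- sup S)^-1).+1%:R^-1 < - sup S.
  by rewrite -[ltRHS]invrK ltf_pV2 ?posrE ?invr_gt0 ?oppr_gt0.
by move: (_.+1%:R^-1) h2 => x h2; lra.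
Qed.

(** Some maximiser exceeds [Z1 - c], hence [-c], while none lies beyond [c' < c], which gives
    strictness to the right. For tilt 1 the profile is the height minus the constant
    [nu1 Nu (- b)]. *)
Lemma exit_cont_peak N Nu t b c c' : loc_fin2 N -> loc_fin1 Nu ->
  ~ heights_unbounded N Nu t -> 0 < c -> c' < c -> c < b ->
  0 <= Z1 N Nu t t <= c' -> cont_peak N Nu 1 t b c t.
Proof.
move=> lf2 lf1 bd c0 c'c cb /andP[Z0 Zc].
set S := [set z | z <= t /\ maximal_at N Nu t z].
have EZ : Z1 N Nu t t = sup S by [].
have [z0 z0t mz0] := maximal_ex lf2 lf1 bd.
have hS : has_sup S by split; [exists z0|exists t => z []].
have ubS z : S z -> z < c.
  move=> Sz; apply: le_lt_trans c'c; apply: le_trans Zc; rewrite EZ.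
  by apply: ub_le_sup => //; case: hS.
have [z [zt mz] zc] := sup_adherent c0 hS.
have tiltE x : tilt 1 t x = x by rewrite /tilt; ring.
have prE x : - b <= x -> tilted_profile N Nu 1 t b x = height N Nu t x - nu1 Nu (- b).
  move=> bx; rewrite /tilted_profile !tiltE divr1 (height_profile _ _ lf1 bx).
  by rewrite addrC addrA addNr add0r.
exists z; first by apply/andP; split; [lra|apply: ubS].
move=> z' /andP[bz' z't].
have le_h : height N Nu t z' <= height N Nu t z by rewrite -mz; exact: L1_ub.
rewrite !prE//; [|lra]; split; first by rewrite lerD2r.
move=> cz'; rewrite ltrD2r lt_neqAle le_h andbT; apply/eqP => E.
by have := ubS z' (conj z't (etrans mz (esym E))); rewrite ltNge cz'.
Qed.

End exit_point.

(** * Measurability of the exit event *)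

Section measurability.
Context {R : realType} {d : measure_display} {Omega : measurableType d}.
Variable P : probability Omega R.
Variables (Pts : Omega -> set (R * R)) (Nu : Omega -> set R).
Hypothesis HS : hammersley_setting P Pts Nu.

Lemma measurable_npts_hbox (p q : R * R) k : 0 <= p.2 ->
  measurable [set w | npts (Pts w `&` hbox p q) = k].
Proof.
move=> p0; case: HS => _ _ _ [+ _ _].
move=> /(_ (hbox p q) k (measurable_hbox p q) (bounded2_hbox p q)).
by move=> /(_ (hbox_half p0))[].
Qed.

Lemma measurable_npts_itv (a b : R) k :
  measurable [set w | npts (Nu w `&` `]a, b]) = k].
Proof.
case: HS => _ _ _ [_ + _].
by move=> /(_ `]a, b]%classic k (measurable_itv _) (bounded1_itv a b))[].
Qed.

(* Consecutive points of a chain are separated by rational points. *)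
Lemma measurable_chain k (p q : R * R) : 0 <= p.2 ->
  measurable [set w | chain (Pts w) q k p].
Proof.
have fin w p' q' := fin_hbox p' q' (@setting_fin2 _ _ _ _ _ _ HS w).
have m0 (p' q' : R * R) : 0 <= p'.2 ->
    measurable [set w | (0 < npts (Pts w `&` hbox p' q'))%N].
  move=> p'0; apply: (measurable_countable
    (X := fun w => npts (Pts w `&` hbox p' q')) (fun n => (0 < n)%N)).
  by move=> x; exact: measurable_npts_hbox.
elim: k p => [|[|k] IH] p p0.
- by rewrite [X in measurable X](_ : _ = setT)//; apply/seteqP; split.
- rewrite [X in measurable X](_ : _ = [set w | (0 < npts (Pts w `&` hbox p q))%N]).
    exact: m0.
  apply/seteqP; split=> w /=; rewrite npts_gt0//.
    by move=> [u [h1 h2 _]]; exists u.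
  by move=> [u [h1 h2]]; exists u.
pose r n : R * R := let x := odflt (0, 0) (choice.unpickle n) in (ratr x.1, ratr x.2).
pose G n := if [&& p.1 < (r n).1, p.2 < (r n).2, (r n).1 < q.1 & (r n).2 < q.2]
  then [set w | (0 < npts (Pts w `&` hbox p (r n)))%N] `&`
       [set w | chain (Pts w) q k.+1 (r n)] else set0.
rewrite [X in measurable X](_ : _ = \bigcup_n G n).
  apply: bigcup_measurable => n _; rewrite /G; case: ifP => // /and4P[h1 h2 h3 h4].
  by apply: measurableI; [exact: m0|apply: IH; lra].
apply/seteqP; split=> w /=.
  move=> [u [Nu' [/= /andP[h1 h2] /andP[h3 h4]] [v [Nv]]]].
  move=> [/= /andP[g1 g2] /andP[g3 g4]] cv.
  have /rat_in_itvoo[x] := g1; rewrite in_itv/= => /andP[x1 x2].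
  have /rat_in_itvoo[y] := g3; rewrite in_itv/= => /andP[y1 y2].
  exists (choice.pickle (x, y)) => //.
  have E : r (choice.pickle (x, y)) = (ratr x, ratr y) by rewrite /r choice.pickleK.
  rewrite /G E /=; rewrite (lt_trans h1 x1) (lt_trans h3 y1) (lt_le_trans x2 g2).
  rewrite (lt_le_trans y2 g4) /=; split => /=.
    rewrite npts_gt0//; exists u; split => //.
    by split; apply/andP; split => //=; exact: ltW.
  by exists v; split => //; split; apply/andP; split.
move=> [n _]; rewrite /G; case: ifP => // /and4P[r1 r2 r3 r4] [/=].
rewrite npts_gt0// => -[u [Nu' [/andP[h1 h2] /andP[h3 h4]]]] cr.
exists u; split => //.
  by split; apply/andP; split => //; [exact: le_trans (ltW r3)|exact: le_trans (ltW r4)].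
by have := @chain_sub _ (Pts w) q q (r n) u k.+1 h2 h4 (lexx _) (lexx _) cr.
Qed.

Lemma measurable_fun_nat (X : Omega -> nat) :
  (forall k, measurable [set w | X w = k]) ->
  measurable_fun setT (fun w => (X w)%:R : R).
Proof.
move=> mX _ B mB; rewrite setTI.
exact: (measurable_countable (X := X) (fun n => B n%:R)).
Qed.

Lemma measurable_height t z : measurable_fun setT (fun w => height (Pts w) (Nu w) t z).
Proof.
have fin w := fin_hbox (z, 0) (t, t) (@setting_fin2 _ _ _ _ _ _ HS w).
apply: measurable_funD.
  rewrite /nu1; case: (0 <= z).
    apply: (measurable_fun_nat (X := fun w => npts (Nu w `&` `]0, z]))) => k.
    exact: measurable_npts_itv.
  apply: measurableT_comp => //.
  apply: (measurable_fun_nat (X := fun w => npts (Nu w `&` `]z, 0]))) => k.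
  exact: measurable_npts_itv.
have LE w : Lpp (Pts w) (z, 0) (t, t) = (Num.truncn (Lpp (Pts w) (z, 0) (t, t)))%:R.
  by have [n -> _] := LppP (fin w); rewrite natrK.
under eq_fun do rewrite LE.
apply: (measurable_fun_nat
  (X := fun w => Num.truncn (Lpp (Pts w) (z, 0) (t, t)))) => k.
(* The last-passage time equals [k] when a chain of length [k] exists but none of length [k + 1]. *)
rewrite [X in measurable X](_ : _ = [set w | chain (Pts w) (t, t) k (z, 0)] `\`
    [set w | chain (Pts w) (t, t) k.+1 (z, 0)]).
  by apply: measurableD; exact: measurable_chain.
apply/seteqP; split=> w /=; have [n -> nP] := LppP (fin w); rewrite natrK.
  by move=> <-; split; [exact/nP|move/(nP n.+1); rewrite ltnn].
move=> [/nP h1 h2]; apply/eqP; rewrite eqn_leq h1 andbT leqNgt.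
by apply/negP => /(nP k.+1).
Qed.

Lemma measurable_heights_unbounded t :
  measurable [set w | heights_unbounded (Pts w) (Nu w) t].
Proof.
rewrite [X in measurable X](_ : _ = \bigcap_k \bigcup_n
  [set w | k%:R < height (Pts w) (Nu w) t (grid_pt t n)]).
  apply: bigcap_measurable => [|k _]; first by exists 0%N.
  apply: bigcup_measurable => n _.
  rewrite [X in measurable X](_ : _ =
      ~` [set w | height (Pts w) (Nu w) t (grid_pt t n) <= k%:R]); last first.
    apply/seteqP; split=> w /=; last by move/negP; rewrite -ltNge.
    by move=> h; apply/negP; rewrite -ltNge.
  apply: measurableC; rewrite -[X in measurable X]setTI.
  by apply: measurable_fun_le => //; exact: measurable_height.
apply/seteqP; split=> w /= h.
  by move=> k _; have [n hn] := h k; exists n.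
by move=> k; have [n _ hn] := h k I; exists n.
Qed.

Lemma measurable_maximal_at t n :
  measurable [set w | maximal_at (Pts w) (Nu w) t (grid_pt t n)].
Proof.
rewrite [X in measurable X](_ : _ =
  (\bigcap_n' [set w | height (Pts w) (Nu w) t (grid_pt t n') <=
                       height (Pts w) (Nu w) t (grid_pt t n)]) `|`
  ([set w | heights_unbounded (Pts w) (Nu w) t] `&`
   [set w | height (Pts w) (Nu w) t (grid_pt t n) = 0])).
  apply: measurableU.
    apply: bigcap_measurable => [|k _]; first by exists 0%N.
    rewrite -[X in measurable X]setTI.
    by apply: measurable_fun_le => //; exact: measurable_height.
  apply: measurableI; first exact: measurable_heights_unbounded.
  rewrite -[X in measurable X]setTI.
  exact: (measurable_height t (grid_pt t n) measurableT (measurable_set1 0)).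
apply/seteqP; split=> w /=;
    rewrite maximal_atE; try exact: (@setting_fin2 _ _ _ _ _ _ HS w);
    try exact: (@setting_fin1 _ _ _ _ _ _ HS w).
  by move=> [h|h]; [left=> n' _; exact: h|right].
by move=> [h|h]; [left=> n'; exact: h|right].
Qed.

Lemma measurable_exit_event eps t : 0 <= eps ->
  measurable (exit_event Pts Nu eps t).
Proof.
move=> e0; set c := eps * t `^ (2 / 3).
have c0 : 0 <= c by rewrite mulr_ge0// powR_ge0.
pose M n := [set w | maximal_at (Pts w) (Nu w) t (grid_pt t n)].
have mM n : measurable (M n) by exact: measurable_maximal_at.
have mcst (A : Prop) (B : set Omega) : measurable B ->
    measurable (B `&` [set w | A]).
  move=> mB; have [a|na] := pselect A.
    by rewrite (_ : [set _ | _] = setT) ?setIT//; apply/seteqP; split.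
  by rewrite (_ : [set _ | _] = set0) ?setI0//; apply/seteqP; split.
rewrite [X in measurable X](_ : _ =
  (\bigcap_n ~` (M n `&` [set _ | ~ (grid_pt t n <= c)])) `&`
  ((\bigcap_n ~` M n) `|`
   (\bigcap_k \bigcup_n (M n `&` [set _ | - k.+1%:R^-1 < grid_pt t n])))).
  apply: measurableI.
    apply: bigcap_measurable => [|n _]; first by exists 0%N.
    by apply: measurableC; exact: mcst.
  apply: measurableU.
    apply: bigcap_measurable => [|n _]; first by exists 0%N.
    exact: measurableC.
  apply: bigcap_measurable => [|k _]; first by exists 0%N.
  by apply: bigcup_measurable => n _; exact: mcst.
apply/seteqP; split=> w; rewrite /exit_event /=;
    rewrite exit_pointE//; try exact: (@setting_fin2 _ _ _ _ _ _ HS w);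
    try exact: (@setting_fin1 _ _ _ _ _ _ HS w).
  move=> [h1 h2]; split; first by move=> n _ [/h1 h3 /= []].
  case: h2 => [h|h]; [by left=> n _; exact: h|right=> k _].
  by have [n [h3 h4]] := h k; exists n.
move=> [h1 h2]; split.
  by move=> n Mn; apply: contrapT => nc; exact: (h1 n I).
case: h2 => [h|h]; [by left=> n; exact: h|right=> k].
by have [n _ [h3 h4]] := h k I; exists n.
Qed.

End measurability.

(** * A strong law for Poisson counts *)

Section poisson_lln.
Context {R : realType} {d : measure_display} {Omega : measurableType d}.
Variable P : probability Omega R.

Lemma geometric_series_lty (a q : R) : 0 <= q -> q < 1 ->
  (\sum_(n <oo) (a * q ^+ n)%:E < +oo)%E.
Proof.
move=> q0 q1; have q1' : `|q| < 1 by rewrite ger0_norm.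
suff -> : (\sum_(n <oo) (a * q ^+ n)%:E)%E = (a * (1 - q)^-1)%:E by exact: ltry.
apply: cvg_lim => //; under eq_fun do rewrite sumEFin.
apply: cvg_EFin; first by near=> n.
have := @cvg_geometric_series _ a q q1'.
by rewrite /geometric /series /=.
Unshelve. all: end_near. Qed.

(** Chernoff bounds make both tails geometric in [n]; the convergent half of Borel-Cantelli then
    applies, whatever the joint law of the counts. *)
Lemma poisson_lln (X : nat -> Omega -> nat) (rho del : R) : 0 <= rho -> 0 < del ->
  (forall n k, measurable [set w | X n w = k]) ->
  (forall n k, P [set w | X n w = k] = (poisson_law (rho * n%:R) k)%:E) ->
  P.-negligible (lim_sup_set (fun n => [set w |
    ~ ((rho - del) * n%:R <= (X n w)%:R <= (rho + del) * n%:R)])).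
Proof.
move=> r0 d0 mX PX.
(* Small enough that [v <= 1/2] and [rho * v <= del / 4]: the second-order term of the exponential
   then costs at most half of the gain [v * del]. *)
pose v := del / (4 * (rho + 1) + 2 * del).
have D0 : 0 < 4 * (rho + 1) + 2 * del by lra.
have v0 : 0 < v by rewrite divr_gt0.
have v1 : v <= 1 / 2 by rewrite /v ler_pdivrMr//; lra.
have rv : rho * v <= del / 4.
  by rewrite /v mulrA ler_pdivrMr//; nra.
have ev : expR v - 1 <= v + 2 * v ^+ 2.
  have h1 := expR_ge1Dx (- v); have h2 := expRxMexpNx_1 v.
  have h3 := expR_gt0 v; nra.
have eNv : expR (- v) - 1 <= - v + v ^+ 2.
  have h1 := expR_ge1Dx v; have h2 := expRxMexpNx_1 v.
  have h3 := expR_gt0 (- v); nra.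
pose q := expR (- (v * del / 2)).
have q0 : 0 <= q by exact: expR_ge0.
have q1 : q < 1.
  by rewrite -expR0 ltr_expR oppr_lt0 divr_gt0// mulr_gt0.
have up n : (P [set w | (rho + del) * n%:R < (X n w)%:R :> R]%R <= (q ^+ n)%:E)%E.
  apply: le_trans (@poisson_chernoff _ _ _ P (X n) (rho * n%:R) (expR v)
    (expR (- (v * ((rho + del) * n%:R)))) (fun k => (rho + del) * n%:R < k%:R)
    _ (expR_ge0 _) (expR_ge0 _) (mX n) (PX n) _) _.
  - by rewrite mulr_ge0.
  - move=> k hk; rewrite -expRM_natl -expRD -[leLHS]expR0 ler_expR.
    by rewrite addrC subr_ge0 mulrC ler_pM2r// ltW.
  - rewrite lee_fin -expRD /q -expRM_natl ler_expR.
    have n0 : 0 <= n%:R :> R by [].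
    have : rho * (expR v - 1) - v * (rho + del) <= - (v * del / 2) by nra.
    move=> /(ler_wpM2r n0); lra.
have lo n : (P [set w | (X n w)%:R < (rho - del) * n%:R :> R]%R <= (q ^+ n)%:E)%E.
  apply: le_trans (@poisson_chernoff _ _ _ P (X n) (rho * n%:R) (expR (- v))
    (expR (v * ((rho - del) * n%:R))) (fun k => k%:R < (rho - del) * n%:R)
    _ (expR_ge0 _) (expR_ge0 _) (mX n) (PX n) _) _.
  - by rewrite mulr_ge0.
  - move=> k hk; rewrite -expRM_natl -expRD -[leLHS]expR0 ler_expR.
    by rewrite mulrN subr_ge0 mulrC ler_pM2l// ltW.
  - rewrite lee_fin -expRD /q -expRM_natl ler_expR.
    have n0 : 0 <= n%:R :> R by [].
    have : rho * (expR (- v) - 1) + v * (rho - del) <= - (v * del / 2) by nra.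
    move=> /(ler_wpM2r n0); lra.
have mF n : measurable [set w |
    ~ ((rho - del) * n%:R <= (X n w)%:R <= (rho + del) * n%:R)].
  exact: (measurable_countable (X := X n) (fun k =>
    ~ ((rho - del) * n%:R <= k%:R <= (rho + del) * n%:R)) (mX n)).
have mup n : measurable [set w | (rho + del) * n%:R < (X n w)%:R :> R].
  exact: (measurable_countable (X := X n)
    (fun k => (rho + del) * n%:R < k%:R :> R) (mX n)).
have mlo n : measurable [set w | (X n w)%:R < (rho - del) * n%:R :> R].
  exact: (measurable_countable (X := X n)
    (fun k => k%:R < (rho - del) * n%:R :> R) (mX n)).
apply/negligibleP.
  apply: bigcap_measurable => [|n _]; first by exists 0%N.
  by apply: bigcup_measurable => k _; exact: mF.
apply: lim_sup_set_cvg0 => //.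
apply: le_lt_trans (geometric_series_lty 2 q0 q1).
apply: lee_nneseries => [n _ _|n _]; first exact: measure_ge0.
apply: (@le_trans _ _ (P ([set w | (X n w)%:R < (rho - del) * n%:R :> R] `|`
    [set w | (rho + del) * n%:R < (X n w)%:R :> R]))).
  apply: le_measure; rewrite ?inE//; first exact: measurableU.
  by move=> w /= /negP; rewrite negb_and -!ltNge => /orP[]; [left|right].
apply: le_trans (measureU2 P (mlo n) (mup n)) _.
have -> : 2 * q ^+ n = q ^+ n + q ^+ n by rewrite mulr_natl mulr2n.
by rewrite EFinD; exact: leeD (lo n) (up n).
Qed.

End poisson_lln.

(** * Linear growth of counts and chains *)

Section linear_growth.
Context {R : realType}.
Implicit Types (N : set (R * R)) (Nu : set R).

(** Monotonicity extends the bounds from large integers to all reals; the additive constant absorbs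
    both the rounding and the range below [n0]. *)
Lemma linear_interpolation (g : R -> R) (rho del : R) n0 :
  0 <= rho -> 0 <= del ->
  (forall x y, 0 <= x -> x <= y -> g x <= g y) -> (forall x, 0 <= g x) ->
  (forall n, (n0 <= n)%N -> (rho - del) * n%:R <= g n%:R <= (rho + del) * n%:R) ->
  forall x, 0 <= x -> (rho - del) * x - (rho + del) * n0.+1%:R <= g x <=
                     (rho + del) * x + (rho + del) * n0.+1%:R.
Proof.
move=> r0 d0 gm g0 H x x0; have /andP[h1 h2] := truncn_itv x0.
set n := Num.truncn x in h1 h2.
have n00 : 0 <= n0%:R :> R by [].
rewrite -!natr1 in h2 *.
have [n0n|nn0] := leqP n0 n.
  have /andP[l1 _] := H n n0n; have /andP[_ l2] := H n.+1 (leqW n0n).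
  have l3 : g n%:R <= g x by exact: gm.
  have l4 : g x <= g n.+1%:R by apply: gm => //; rewrite -natr1 ltW.
  rewrite -natr1 in l2 l4.
  by apply/andP; split; nra.
have /andP[_ l2] := H n0 (leqnn _).
have nn0' : n%:R + 1 <= n0%:R :> R by rewrite natr1 ler_nat.
have l4 : g x <= g n0%:R by apply: gm => //; lra.
have := g0 x.
by move=> gx; apply/andP; split; nra.
Qed.

Lemma npts_hbox_split N x y p2 q2 t : loc_fin2 N -> x <= y -> y <= t ->
  (npts (N `&` hbox (x, p2) (y, q2)) + npts (N `&` hbox (y, p2) (t, q2))
   <= npts (N `&` hbox (x, p2) (t, q2)))%N.
Proof.
move=> lf xy yt; rewrite -npts_disjU; [|exact: fin_hbox..|].
  apply: npts_le; first exact: fin_hbox.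
  move=> u [] [Nu' [/= /andP[h1 h2] /andP[h3 h4]]]; split => //.
    by split; apply/andP; split => //=; lra.
  by split; apply/andP; split => //=; lra.
rewrite -subset0 => u [[_ [/= /andP[_ h1] _]] [_ [/= /andP[h2 _] _]]].
lra.
Qed.

(** A chain uses disjoint horizontal stretches in the successive rows, so the main terms telescope
    to [h * (t - x)], the contribution of a single row. Only the errors accumulate, two per row
    since a stretch is a difference of two counts up to [t]. *)
Lemma chain_rows N (t h del C : R) (a : nat) : loc_fin2 N -> 0 <= del -> 0 <= h ->
  t = a%:R * h ->
  (forall i x, (i < a)%N -> x <= t ->
    (h - del) * (t - x) - C <=
      (npts (N `&` hbox (x, i%:R * h) (t, i.+1%:R * h)))%:R <=
    (h + del) * (t - x) + C) ->
  forall j i x k, (i + j)%N = a -> x <= t -> chain N (t, t) k (x, i%:R * h) ->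
    k%:R <= (h + 2 * j%:R * del) * (t - x) + 2 * j%:R * C.
Proof.
move=> lf d0 h0 ta HM; elim=> [|j IH] i x k ija xt ck.
  case: k ck => [_|k [u [_ [_ /= /andP[h1 h2]] _]]].
    by rewrite !mulr0 !mul0r !addr0 mulr_ge0// subr_ge0.
  by move: h1 h2; rewrite -ija addn0 in ta; rewrite -ta => h1 h2; lra.
have ia : (i < a)%N by rewrite -ija addnS ltnS leq_addr.
have [|k1 [k2 [y [-> /andP[/= xy yt] c1 c2]]]] :=
    @chain_split _ N (t, t) k (x, i%:R * h) (i.+1%:R * h) xt _ ck.
  by rewrite /= ler_wpM2r// ler_nat.
have l1 := chain_npts (fin_hbox _ _ lf) c1.
have ija' : (i.+1 + j)%N = a by rewrite addSnnS.
have l2 := IH i.+1 y k2 ija' yt c2.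
have /andP[_ u1] := HM i x ia xt; have /andP[u2 _] := HM i y ia yt.
have := npts_hbox_split (i%:R * h) (i.+1%:R * h) lf xy yt.
rewrite -(ler_nat R) natrD => u3.
have l1' : k1%:R <= (npts (N `&` hbox (x, i%:R * h) (y, i.+1%:R * h)))%:R :> R.
  by rewrite ler_nat.
have dy : del * (t - y) <= del * (t - x) by rewrite ler_wpM2l//; lra.
have jd : 2 * j%:R * del * (t - y) <= 2 * j%:R * del * (t - x).
  by rewrite ler_wpM2l ?mulr_ge0//; lra.
rewrite natrD -natr1; nra.
Qed.

End linear_growth.

(** * Almost sure boundedness of the heights *)

Section heights_bounded_as.
Context {R : realType} {d : measure_display} {Omega : measurableType d}.
Variable P : probability Omega R.
Variables (Pts : Omega -> set (R * R)) (Nu : Omega -> set R).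
Hypothesis HS : hammersley_setting P Pts Nu.

(** Far to the left [nu1] decreases with slope close to 1, while cutting the strip into thin rows
    shows that the longest chain grows with a smaller slope. *)
Lemma heights_unbounded_null t : 0 < t ->
  P [set w | heights_unbounded (Pts w) (Nu w) t] = 0%E.
Proof.
(* With [a > 2 t] rows the row height [h] is at most [1/2], and [del] satisfies
   [(2 a + 1) del = 1/2]; hence the chain slope [h + 2 a del] is at most [1 - del], the lower slope
   of [Nu]. *)
move=> t0; pose a := (Num.truncn (2 * t)).+1.
have a0 : 0 < a%:R :> R by rewrite ltr0n.
pose h := t / a%:R; pose del : R := (2 * (2 * a%:R + 1))^-1.
have h0 : 0 < h by rewrite divr_gt0.
have ta : t = a%:R * h by rewrite mulrC divfK// gt_eqF.
have hh : h <= 1 / 2.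
  by rewrite /h ler_pdivrMr//; have := truncnS_gt (2 * t); rewrite -/a; lra.
have D0 : 0 < 2 * (2 * a%:R + 1) :> R by lra.
have d0 : 0 < del by rewrite invr_gt0.
have dE : (2 * a%:R + 1) * del = 1 / 2.
  by rewrite /del; field; lra.
pose X i n w := npts (Pts w `&` hbox (t - n%:R, i%:R * h) (t, i.+1%:R * h)).
pose Y n w := npts (Nu w `&` `]t - n%:R, t]).
have tn n : t - n%:R <= t by rewrite gerBl.
have LX i n k : measurable [set w | X i n w = k] /\
    P [set w | X i n w = k] = (poisson_law (h * n%:R) k)%:E.
  have [|||m1 m2] := @setting_hbox _ _ _ _ _ _ HS (t - n%:R, i%:R * h)
    (t, i.+1%:R * h) k => //=.
  - by rewrite mulr_ge0// ltW.
  - by rewrite ler_wpM2r ?ler_nat// ltW.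
  split => //; rewrite m2 /=; congr (poisson_law _ _)%:E.
  by rewrite -natr1; ring.
have LY n k : measurable [set w | Y n w = k] /\
    P [set w | Y n w = k] = (poisson_law (1 * n%:R) k)%:E.
  have [m1 m2] := setting_itv HS k (tn n).
  by split => //; rewrite m2; congr (poisson_law _ _)%:E; ring.
have negX i := poisson_lln (ltW h0) d0 (fun n k => (LX i n k).1)
  (fun n k => (LX i n k).2).
have negY := poisson_lln ler01 d0 (fun n k => (LY n k).1) (fun n k => (LY n k).2).
apply: measure_negligible; first exact: measurable_heights_unbounded HS t.
apply: negligibleS (negligibleU negY (negligible_bigcup negX)).
move=> w /= Uw; apply: contrapT => /not_orP[nY nX].
have lf2 := @setting_fin2 _ _ _ _ _ _ HS w.
have lf1 := @setting_fin1 _ _ _ _ _ _ HS w.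
have evP (F : nat -> Prop) : ~ (forall n, True -> exists2 k, (n <= k)%N & ~ F k) ->
    exists n0, forall n, (n0 <= n)%N -> F n.
  move=> H; apply: contrapT => nH; apply: H => n _; apply: contrapT => H.
  apply: nH; exists n => k nk; apply: contrapT => nF; apply: H.
  by exists k.
have [nY0 HY] := evP _ nY.
have HX i : exists n0, forall n, (n0 <= n)%N ->
    (h - del) * n%:R <= (X i n w)%:R <= (h + del) * n%:R.
  by apply: evP => H; apply: nX; exists i.
have {}HX m : exists n0, forall i n, (i < m)%N -> (n0 <= n)%N ->
    (h - del) * n%:R <= (X i n w)%:R <= (h + del) * n%:R.
  elim: m => [|m [n1 IH]]; first by exists 0%N.
  have [n2 H2] := HX m; exists (maxn n1 n2) => i n.
  rewrite geq_max ltnS leq_eqVlt => /orP[/eqP->|im] /andP[g1 g2].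
    exact: H2.
  exact: IH.
have {HX}[nX0 HX] := HX a.
pose C := (1 + h + del) * (maxn nX0 nY0).+1%:R.
have C1 (r : R) (n : nat) : 0 <= r -> r <= 1 + h -> (n <= maxn nX0 nY0)%N ->
    (r + del) * n.+1%:R <= C.
  move=> r0 r1 n1; apply: ler_pM; rewrite ?ler_nat//; lra.
have rows i x : (i < a)%N -> x <= t ->
    (h - del) * (t - x) - C <=
      (npts (Pts w `&` hbox (x, i%:R * h) (t, i.+1%:R * h)))%:R <=
    (h + del) * (t - x) + C.
  move=> ia xt.
  pose g y : R := (npts (Pts w `&` hbox (t - y, i%:R * h) (t, i.+1%:R * h)))%:R.
  have gm x' y : 0 <= x' -> x' <= y -> g x' <= g y.
    move=> _ xy; rewrite ler_nat; apply: npts_le; first exact: fin_hbox.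
    move=> u [Nu' [/= /andP[h1 h2] /andP[h3 h4]]]; split => //.
    by split; apply/andP; split => //=; lra.
  have g0 y : 0 <= g y by rewrite ler0n.
  have dx : 0 <= t - x by rewrite subr_ge0.
  have := @linear_interpolation _ g h del nX0 (ltW h0) (ltW d0) gm g0
    (fun n => HX i n ia) _ dx.
  rewrite /g (_ : t - (t - x) = x); last by ring.
  have hC : (h + del) * nX0.+1%:R <= C by apply: C1 (ltW h0) _ (leq_maxl _ _); lra.
  by move=> /andP[g1 g2]; apply/andP; split; lra.
have line x : x <= t -> (1 - del) * (t - x) - C <= (npts (Nu w `&` `]x, t]))%:R.
  move=> xt; pose g y : R := (npts (Nu w `&` `]t - y, t]))%:R.
  have gm x' y : 0 <= x' -> x' <= y -> g x' <= g y.
    move=> _ xy; rewrite ler_nat; apply: npts_le; first exact: fin_itv.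
    move=> u [Nu' /=]; rewrite in_itv/= => /andP[h1 h2]; split => //=.
    by rewrite in_itv/= h2 andbT; lra.
  have g0 y : 0 <= g y by rewrite ler0n.
  have dx : 0 <= t - x by rewrite subr_ge0.
  have := @linear_interpolation _ g 1 del nY0 ler01 (ltW d0) gm g0 HY _ dx.
  rewrite /g (_ : t - (t - x) = x); last by ring.
  have hC : (1 + del) * nY0.+1%:R <= C by apply: C1 ler01 _ (leq_maxr _ _); lra.
  by move=> /andP[g1 g2]; lra.
pose B := nu1 (Nu w) t + (2 * a%:R + 1) * C.
have [n] := Uw (Num.truncn `|B|).+1.
set z := grid_pt t n; have zt : z <= t by exact: grid_pt_le.
have [l El lP] := LppP (fin_hbox (z, 0) (t, t) lf2).
have cl : chain (Pts w) (t, t) l (z, 0%:R * h) by rewrite mul0r; exact/lP.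
have hl := chain_rows lf2 (ltW d0) (ltW h0) ta rows (add0n a) zt cl.
have hz := line z zt.
have Ez : height (Pts w) (Nu w) t z =
    nu1 (Nu w) t - (npts (Nu w `&` `]z, t]))%:R + l%:R.
  by rewrite /height El (nu1_diff lf1 zt); ring.
rewrite Ez => hB.
have h1 := truncnS_gt `|B|; have h2 := ler_norm B.
have h3 : (h + 2 * a%:R * del - (1 - del)) * (t - z) <= 0.
  rewrite mulr_le0_ge0 ?subr_ge0//; lra.
rewrite /B in h2 h1 hB; lra.
Qed.

End heights_bounded_as.

(** * Bound for the exit event, and the limit *)

Lemma exit_event_bound (R : realType) (d : measure_display)
    (Omega : measurableType d) (P : probability Omega R)
    (Pts : Omega -> set (R * R)) (Nu : Omega -> set R) (K : nat) (a eps t : R) :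
  hammersley_setting P Pts Nu -> (0 < K)%N -> 0 < a -> 0 <= eps ->
  eps < K%:R^-1 -> 8 ^+ 3 <= t ->
  (P (exit_event Pts Nu eps t) <= (expR 128 * (a / K%:R + a^-1))%:E)%E.
Proof.
move=> HS K0 a0 e0 eK t8.
have t0 : 0 < t by apply: lt_le_trans t8; rewrite exprn_gt0.
pose u := t `^ 3^-1; have u0 : 0 < u by exact: powR_gt0.
have u3 : u ^+ 3 = t.
  by rewrite -powR_mulrn ?(ltW u0)// -powRrM mulVf// powRr1// ltW.
have u2 : t `^ (2 / 3) = u ^+ 2.
  by rewrite -powR_mulrn ?(ltW u0)// -powRrM mulrC.
have u8 : 8 <= u.
  by rewrite -(@ler_pXn2r _ 3) ?nnegrE ?(ltW u0)// u3.
have s0 : 0 < u ^+ 2 by rewrite exprn_gt0.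
pose U := [set w | heights_unbounded (Pts w) (Nu w) t].
have mU : measurable U by exact: (measurable_heights_unbounded HS).
have mE : measurable (exit_event Pts Nu eps t).
  exact: (measurable_exit_event HS).
have mEU : measurable (exit_event Pts Nu eps t `\` U) by exact: measurableD.
(* Discard the null event of unbounded heights; elsewhere [eps < 1/K] leaves the strict room that
   [exit_cont_peak] requires. *)
apply: (@le_trans _ _ (P (exit_event Pts Nu eps t `\` U) + P U)%E).
  apply: le_trans (measureU2 P mEU mU).
  apply: le_measure; rewrite ?inE//; first exact: measurableU.
  by move=> w Ew; have [Uw|Uw] := pselect (U w); [right|left].
rewrite (heights_unbounded_null HS t0) adde0.
apply: (cont_peak_bound HS u8) => // w [Ew nU] /=; rewrite u3.
have K1 : 1 <= K%:R :> R by rewrite ler1n.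
apply: (@exit_cont_peak _ _ _ _ _ _ (eps * u ^+ 2)) => //.
- exact: (@setting_fin2 _ _ _ _ _ _ HS w).
- exact: (@setting_fin1 _ _ _ _ _ _ HS w).
- by rewrite divr_gt0// ltr0n.
- by rewrite mulrC ltr_pM2l.
- rewrite ltr_pdivrMr ?ltr0n//; nra.
- by rewrite -u2; exact: Ew.
Qed.

Theorem theorem5p15 (R : realType) (d : measure_display)
    (Omega : measurableType d) (P : probability Omega R)
    (Pts : Omega -> set (R * R)) (Nu : Omega -> set R) :
  hammersley_setting P Pts Nu ->
  (fun eps : R =>
     limf_esup (fun t : R => P (exit_event Pts Nu eps t)) (pinfty_nbhs R))
    @ 0^'+ --> (0 : \bar R).
Proof.
move=> HS.
have ge0 eps : (0 <= limf_esup (fun t : R => P (exit_event Pts Nu eps t))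
    (pinfty_nbhs R))%E.
  apply: limf_esup_ge0 => [|t]; last exact: measure_ge0.
  by move=> [M [_ HM]]; apply: (HM (M + 1)); rewrite ltrDl.
have le_e (e : R) : 0 < e -> \forall eps \near 0^'+,
    (limf_esup (fun t : R => P (exit_event Pts Nu eps t)) (pinfty_nbhs R)
     <= e%:E)%E.
  move=> e0; pose g : R := expR 128; have g0 : 0 < g by exact: expR_gt0.
  (* Since [K > a^2], the term [a / K] is at most [1 / a], and this [a] makes the bound [2 g / a]
     equal to [e]. *)
  pose a := 2 * g / e; have a0 : 0 < a by rewrite divr_gt0// mulr_gt0.
  pose K := (Num.truncn (a ^+ 2)).+1.
  have K0 : 0 < K%:R :> R by rewrite ltr0n.
  have aK : a / K%:R <= a^-1.
    rewrite ler_pdivrMr// mulrC ler_pdivlMr// -expr2 ltW//.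
    exact: truncnS_gt.
  near=> eps; rewrite limf_esupE.
  apply: (@le_trans _ _ (ereal_sup
    ((fun t => P (exit_event Pts Nu eps t)) @` [set t | 8 ^+ 3 < t]))).
    apply: ereal_inf_lbound; exists [set t | 8 ^+ 3 < t] => //.
    by exists (8 ^+ 3); split.
  apply: ge_ereal_sup => _ [t /= t8 <-].
  apply: (@le_trans _ _ (g * (a / K%:R + a^-1))%:E).
    apply: exit_event_bound (ltW t8) => //.
    near: eps; apply: nbhs_right_lt; by rewrite invr_gt0.
  rewrite lee_fin.
  have -> : e = g * (a^-1 + a^-1) by rewrite /a; field; rewrite !gt_eqF.
  by rewrite ler_pM2l// lerD2r.
have fin_near : \forall eps \near 0^'+,
    limf_esup (fun t : R => P (exit_event Pts Nu eps t)) (pinfty_nbhs R)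
      \is a fin_num.
  near=> eps; rewrite ge0_fin_numE//; apply: (@le_lt_trans _ _ 1%:E) (ltry _).
  by near: eps; exact: le_e.
apply/fine_cvgP; split => //.
apply/cvgrPdist_le => e e0; near=> eps.
rewrite /= sub0r normrN ger0_norm ?fine_ge0//.
rewrite -lee_fin fineK; last by near: eps.
by near: eps; exact: le_e.
Unshelve. all: end_near. Qed.
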